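(* Let $X$ be an infinite-dimensional complex Hilbert space with open unit ball $B_X$, let $\mu,\nu$ be normal weights on $B_X$, let $\psi\in H(B_X)$ and $\varphi\in S(B_X)$. Assume that $W_{\psi,\varphi}:\mathcal{B}_\nu(B_X)\to\mathcal{B}_\mu(B_X)$, $f\mapsto\psi\cdot(f\circ\varphi)$, is compact. Then $\varphi(rB_X)$ is relatively compact for every $0\le r<1$.
   Context: A positive continuous function $\mu$ on $[0,1)$ is normal if there are constants $0\le\delta<1$, $0<a<b<\infty$ such that $\mu(t)/(1-t)^a$ is decreasing on $[\delta,1)$ with limit $0$ as $t\to1$, and $\mu(t)/(1-t)^b$ is increasing on $[\delta,1)$ with limit $\infty$ as $t\to1$. A normal weight on $B_X$ is $\mu(z)=\mu(\|z\|)$. $H(B_X)$ is the space of holomorphic functions $B_X\to\mathbb{C}$, $S(B_X)$ the set of holomorphic self-maps of $B_X$. For $f\in H(B_X)$, $Rf(z)=f'(z)(z)$. $\mathcal{B}_\mu(B_X)$ is the space of $f\in H(B_X)$ with $\sup_{z\in B_X}\mu(z)|Rf(z)|<\infty$, normed by $\|f\|=|f(0)|+\sup_{z\in B_X}\mu(z)|Rf(z)|$.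
   Formalization: The formal theorem additionally assumes that ψ is not identically zero on B_X; for ψ = 0 the operator is zero, hence compact, while φ(z) = z/2 maps rB_X (0 < r < 1) onto a set that is not relatively compact. *)

(* Defs.v *)
From HB Require Import structures.
From mathcomp Require Import all_boot all_order all_algebra.
From mathcomp Require Import sesquilinear complex.
From mathcomp Require Import all_classical all_reals all_analysis.

Set Implicit Arguments.
Unset Strict Implicit.
Unset Printing Implicit Defensive.

Import Order.TTheory GRing.Theory Num.Theory.
Import numFieldNormedType.Exports.

Local Open Scope classical_set_scope.
Local Open Scope complex_scope.
Local Open Scope ring_scope.

(* Norms over [R[i]] take values in [R[i]]; [rnorm] is the same norm, in [R].  *)
Definition rnorm {R : realType} {V : normedModType R[i]} (x : V) : R :=
  complex.Re `|x|.

Definition infinite_dim {K : fieldType} (V : lmodType K) : Prop :=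
  forall (n : nat) (e : 'I_n -> V),
    ~ (forall x : V, exists c : 'I_n -> K, x = \sum_(i < n) c i *: e i).

Definition unit_ball {R : realType} (X : normedModType R[i]) : set X :=
  [set z | rnorm z < 1].
Arguments unit_ball {R} X.

(* [f] is a total function, but only its values on the open unit ball matter. *)
Definition holomorphic {R : realType} {X Y : normedModType R[i]} (f : X -> Y) :
    Prop :=
  forall z, unit_ball X z -> differentiable f z.

Definition holomorphic_self_map {R : realType} {X : normedModType R[i]}
    (phi : X -> X) : Prop :=
  holomorphic phi /\ (forall z, unit_ball X z -> unit_ball X (phi z)).

Definition normal {R : realType} (mu : R -> R) : Prop :=
  [/\ {within `[0, 1[, continuous mu},
      (forall t : R, 0 <= t < 1 -> 0 < mu t) &
      exists d a b : R,
      [/\ 0 <= d < 1, 0 < a & a < b] /\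
      [/\ {in `[d, 1[ &, forall s t, s <= t ->
             mu t / (1 - t) `^ a <= mu s / (1 - s) `^ a},
          mu t / (1 - t) `^ a @[t --> 1^'-] --> (0 : R),
          {in `[d, 1[ &, forall s t, s <= t ->
             mu s / (1 - s) `^ b <= mu t / (1 - t) `^ b} &
          mu t / (1 - t) `^ b @[t --> 1^'-] --> +oo] ].

Record normal_weight (R : realType) := NormalWeight {
  weight :> R -> R;
  weightP : normal weight }.

Lemma weight_gt0 (R : realType) (mu : normal_weight R) t :
  0 <= t < 1 -> 0 < mu t.
Proof. by case: (weightP mu) => _ + _; exact. Qed.

Section rnorm.
Variables (R : realType) (V : normedModType R[i]).
Implicit Types x y : V.

Lemma rnormE x : (rnorm x)%:C = `|x|.
Proof. by rewrite /rnorm RRe_real// ger0_real. Qed.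

Lemma rnorm_ge0 x : 0 <= rnorm x.
Proof. by rewrite -ler0c rnormE. Qed.

Lemma ler_rnormD x y : rnorm (x + y) <= rnorm x + rnorm y.
Proof. by rewrite -lecR rmorphD/= !rnormE ler_normD. Qed.

Lemma rnormZ (l : R[i]) x : rnorm (l *: x) = rnorm (l : R[i]^o) * rnorm x.
Proof. by apply: complexI; rewrite rmorphM/= !rnormE normrZ. Qed.

Lemma rnorm_eq0 x : (rnorm x == 0) = (x == 0).
Proof. by rewrite -(inj_eq (@complexI R)) rnormE normr_eq0. Qed.

Lemma rnorm0 : rnorm (0 : V) = 0.
Proof. by apply/eqP; rewrite rnorm_eq0. Qed.

End rnorm.

Section ray.
Variables (R : realType) (X : normedModType R[i]).
Local Notation C := (R[i]^o).
Implicit Types (f : X -> C) (z : X).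

Lemma unit_ball0 : unit_ball X 0.
Proof. by rewrite /unit_ball/= rnorm0. Qed.

Lemma rnormZr (t : R) z : 0 <= t -> rnorm (t%:C *: z) = t * rnorm z.
Proof.
by move=> t0; rewrite rnormZ; congr (_ * _); apply: complexI;
  rewrite rnormE ger0_norm// ler0c.
Qed.

Lemma unit_ballZ (t : R) z :
  0 <= t <= 1 -> unit_ball X z -> unit_ball X (t%:C *: z).
Proof.
rewrite /unit_ball/= => /andP[t0 t1] z1; rewrite rnormZr//.
by rewrite (le_lt_trans _ z1)// ler_piMl// rnorm_ge0.
Qed.

Lemma differentiable_rnorm f z (e : R) : differentiable f z -> 0 < e ->
  exists2 d : R, 0 < d & forall h, rnorm h < d ->
    rnorm (f (h + z) - f z - 'd f z h) <= e * rnorm h.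
Proof.
move=> /diff_locallyxP[_ fz] e0.
have e0' : 0 < e%:C by rewrite ltcR.
have [k kP] : exists k : @littleo_type R[i] X C X (nbhs (0 : X)) id, forall h,
    f (h + z) - f z - 'd f z h = k h.
  by eexists => h; rewrite fz -addrA -opprD [X in X - _]addrC addrK.
have /nbhs_ballP[d d0 H] := littleoP k e0'.
have dE : d = (complex.Re d)%:C by rewrite RRe_real// gtr0_real.
exists (complex.Re d); first by rewrite -ltcR -dE.
move=> h hd; rewrite -lecR rmorphM/= !rnormE.
have bh : ball (0 : X) d h.
  by rewrite -ball_normE/= sub0r normrN dE -rnormE ltcR.
by have := H h bh; rewrite /= -kP.
Qed.

Section ray_part.
Variable P : R[i] -> R.
Hypotheses (PB : forall x y, P (x - y) = P x - P y).
Hypotheses (Ple : forall x : C, `|P x| <= rnorm x).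

Lemma part_ray_cst f z : holomorphic f -> unit_ball X z ->
  (forall w, unit_ball X w -> 'd f w w = 0) -> P (f z) = P (f 0).
Proof.
move=> hf z1 df0.
have Bt t : 0 <= t <= 1 -> unit_ball X (t%:C *: z) by move=> ?; exact: unit_ballZ.
have H (t e : R) : 0 <= t <= 1 -> 0 < e -> exists2 d, 0 < d & forall s, `|s| < d ->
   `|P (f ((t + s)%:C *: z)) - P (f (t%:C *: z)) - P ('d f (t%:C *: z) (s%:C *: z))|
     <= e * `|s|.
  move=> t01 e0.
  have := differentiable_rnorm (hf _ (Bt _ t01)) e0 => -[d d0 hd].
  have [z0|z0] := eqVneq z 0.
    exists 1 => // s _; rewrite z0 !scaler0 -!PB subrr raddf0 subr0.
    rewrite (le_trans (Ple _))// (_ : rnorm _ = 0) ?mulr_ge0 ?(ltW e0)//.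
    by apply/eqP; rewrite rnorm_eq0.
  have rz : 0 < rnorm z by rewrite lt_neqAle rnorm_ge0 eq_sym rnorm_eq0 z0.
  have sz s : rnorm (s%:C *: z) = `|s| * rnorm z.
    rewrite rnormZ; congr (_ * _); apply: complexI; rewrite rnormE.
    by rewrite [LHS]normc_def/= expr0n addr0 sqrtr_sqr.
  exists d => // s sd; rewrite -!PB (le_trans (Ple _))//.
  have -> : (t + s)%:C *: z = s%:C *: z + t%:C *: z.
    by rewrite rmorphD/= scalerDl addrC.
  rewrite (le_trans (hd _ _))//.
    by rewrite sz (le_lt_trans _ sd)// ler_piMr// ltW.
  by rewrite sz ler_wpM2l ?(ltW e0)// ler_piMr// ltW.
pose h t := P (f (t%:C *: z)).
have h' (t : R) : t \in `]0, 1[ -> is_derive t 1 h 0.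
  rewrite in_itv/= => /andP[t0 t1].
  have d0 s : 'd f (t%:C *: z) (s%:C *: z) = 0.
    have -> : s%:C *: z = (s / t)%:C *: (t%:C *: z).
      by rewrite scalerA -rmorphM/= divfK// gt_eqF.
    have B : unit_ball X (t%:C *: z) by apply: Bt; rewrite !ltW.
    by rewrite linearZ/= (df0 _ B) scaler0.
  have cv : s^-1 *: (h (s *: 1 + t) - h t) @[s --> 0^'] --> (0 : R).
    apply/cvgrPdist_le => e e0.
    have t01 : 0 <= t <= 1 by rewrite !ltW.
    have [d dp hd] := H t e t01 e0.
    near=> s.
    have s0 : s != 0 by near: s; exact: nbhs_dnbhs_neq.
    have sd : `|s| < d.
      near: s; apply: nbhs_dnbhs; near=> s.
      rewrite -[s]subr0 distrC; near: s.
      by apply/nbhs_ballP; exists d => //= y; rewrite -ball_normE.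
    rewrite sub0r normrN normrM normfV.
    rewrite ler_pdivrMl ?normr_gt0// mulrC.
    have := hd _ sd; rewrite d0 (_ : P 0 = 0) ?subr0; last first.
      by rewrite -(subrr (0 : R[i])) PB subrr.
    by rewrite /h (_ : s *: 1 = s) 1?[t + s]addrC//; exact: mulr1.
  by apply: DeriveDef; [apply/cvg_ex; exists 0 | apply: cvg_lim].
have hc : {within `[0, 1], continuous h}.
  apply: continuous_in_subspaceT => t; rewrite inE/= in_itv/= => t01.
  have [d dp hd] := H t 1 t01 ltr01.
  set w := 'd f (t%:C *: z) z.
  have M0 : 0 < 1 + rnorm w by rewrite ltr_pwDl// rnorm_ge0.
  apply/cvgrPdist_le => e e0.
  near=> s.
  have sd : `|s - t| < d.
    rewrite distrC; near: s.
    by exists d.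
  have se : `|s - t| <= e / (1 + rnorm w).
    rewrite distrC; near: s; exists (e / (1 + rnorm w)).
      by rewrite /= divr_gt0.
    by move=> y /= /ltW.
  have := hd _ sd; rewrite [t + _]addrC subrK mul1r linearZ/= -/w => hs.
  have ws : `|P ((s - t)%:C *: (w : C))| <= `|s - t| * rnorm w.
    rewrite (le_trans (Ple _))// rnormZ ler_wpM2r ?rnorm_ge0//.
    by rewrite -lecR rnormE [leLHS]normc_def/= expr0n addr0 sqrtr_sqr.
  rewrite distrC /h -[X in `|X|](subrK (P ((s - t)%:C *: (w : C)))).
  rewrite (le_trans (ler_normD _ _))// (le_trans (lerD hs ws))//.
  by rewrite -[X in X + _]mulr1 -mulrDr -ler_pdivlMr.
have [c c01 /esym/eqP] := MVT ltr01 h' hc.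
by rewrite mul0r eq_sym subr_eq0 /h scale1r scale0r => /eqP.
Unshelve. all: by end_near. Qed.
End ray_part.

Lemma ray_cst f z : holomorphic f -> unit_ball X z ->
  (forall w, unit_ball X w -> 'd f w w = 0) -> f z = f 0.
Proof.
move=> hf z1 df0; apply/eqP; rewrite eq_complex; apply/andP; split; apply/eqP.
- apply: (part_ray_cst (P := @complex.Re R)) => //.
  + by move=> [? ?] [? ?].
  + move=> x; rewrite -lecR rnormE.
    exact: normc_ge_Re.
- apply: (part_ray_cst (P := @complex.Im R)) => //.
  + by move=> [? ?] [? ?].
  + move=> [a b]; rewrite -lecR rnormE normc_def/= lecR.
    by rewrite -sqrtr_sqr ler_wsqrtr// lerDr sqr_ge0.
Qed.
End ray.

Definition radial_derivative {R : realType} {X : normedModType R[i]}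
    (f : X -> R[i]^o) (z : X) : R[i]^o := 'd f z z.

Definition bloch_values {R : realType} {X : normedModType R[i]} (mu : R -> R)
    (f : X -> R[i]^o) : set R :=
  [set mu (rnorm z) * rnorm (radial_derivative f z) | z in unit_ball X].

(* A function on the open unit ball is represented by the total function that *)
(* extends it by 0, so that equality is equality on the ball.                  *)
Definition bloch_pred {R : realType} (X : normedModType R[i]) (mu : R -> R) :
    {pred X -> R[i]^o} :=
  fun f => `[< [/\ holomorphic f, (forall z, ~ unit_ball X z -> f z = 0) &
                   has_ubound (bloch_values mu f)] >].
Arguments bloch_pred {R} X mu.

Record bloch {R : realType} (X : normedModType R[i]) (mu : normal_weight R) :=
  Bloch {
    bloch_fun :> X -> R[i]^o;
    _ : bloch_fun \in bloch_pred X mu }.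

HB.instance Definition _ (R : realType) (X : normedModType R[i])
    (mu : normal_weight R) := [isSub for @bloch_fun R X mu].
HB.instance Definition _ (R : realType) (X : normedModType R[i])
    (mu : normal_weight R) := [Choice of bloch X mu by <:].

Section bloch_submod.
Variables (R : realType) (X : normedModType R[i]) (mu : normal_weight R).
Local Notation C := (R[i]^o).
Implicit Types (f g : X -> C).

Lemma weight_rnorm_gt0 z : unit_ball X z -> 0 < mu (rnorm z).
Proof. by move=> z1; apply: weight_gt0; rewrite rnorm_ge0. Qed.

Lemma radial_derivativeD f g z : differentiable f z -> differentiable g z ->
  radial_derivative (f + g) z = radial_derivative f z + radial_derivative g z.
Proof. by move=> df dg; exact: (congr1 (@^~ z) (diffD df dg)). Qed.

Lemma radial_derivativeZ (l : R[i]) f z : differentiable f z ->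
  radial_derivative (l *: f) z = l *: radial_derivative f z.
Proof. by move=> df; exact: (congr1 (@^~ z) (diffZ l df)). Qed.

Lemma bloch_values_ubD f g (a b : R) : holomorphic f -> holomorphic g ->
  ubound (bloch_values mu f) a -> ubound (bloch_values mu g) b ->
  ubound (bloch_values mu (f + g)) (a + b).
Proof.
move=> hf hg fa gb _ [z z1 <-]; rewrite radial_derivativeD; last 2 first.
  exact: hf.
  exact: hg.
rewrite (@le_trans _ _ (mu (rnorm z) * rnorm (radial_derivative f z) +
                        mu (rnorm z) * rnorm (radial_derivative g z)))//.
  by rewrite -mulrDr ler_wpM2l ?ler_rnormD// ltW// weight_rnorm_gt0.
by rewrite lerD//; [apply: fa | apply: gb]; exists z.
Qed.

Lemma bloch_values_ubZ (l : R[i]) f (a : R) : holomorphic f ->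
  ubound (bloch_values mu f) a ->
  ubound (bloch_values mu (l *: f)) (rnorm (l : C) * a).
Proof.
move=> hf fa _ [z z1 <-]; rewrite radial_derivativeZ; last exact: hf.
by rewrite rnormZ mulrCA ler_wpM2l ?rnorm_ge0//; apply: fa; exists z.
Qed.

Lemma bloch_submod_closed : submod_closed (bloch_pred X mu).
Proof.
split=> [|l f g /asboolP[hf f0 [a fa]] /asboolP[hg g0 [b gb]]].
  apply/asboolP; split; [by move=> z _; exact: differentiable_cst | by [] |].
  exists 0 => _ [z _ <-].
  have -> : radial_derivative (0 : X -> C) z = 0.
    exact: (congr1 (@^~ z) (diff_cst (0 : C) z)).
  by rewrite rnorm0 mulr0.
have hlf : holomorphic (l *: f) by move=> z z1; apply: differentiableZ; exact: hf.
apply/asboolP; split.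
- by move=> z z1; apply: differentiableD; [exact: hlf | exact: hg].
- by move=> z z1; rewrite !fctE f0// g0// scaler0 addr0.
- exists (rnorm (l : C) * a + b).
  exact: (bloch_values_ubD hlf hg (bloch_values_ubZ (l := l) hf fa) gb).
Qed.

HB.instance Definition _ :=
  GRing.isSubmodClosed.Build R[i] (X -> C) (bloch_pred X mu) bloch_submod_closed.

HB.instance Definition _ := [SubChoice_isSubLmodule of bloch X mu by <:].

End bloch_submod.

Section bloch_norm.
Variables (R : realType) (X : normedModType R[i]) (mu : normal_weight R).
Local Notation C := (R[i]^o).
Implicit Types f g : bloch X mu.

Definition bloch_norm f : R[i] :=
  (rnorm (f 0) + sup (bloch_values mu f))%:C.

Lemma bloch_holomorphic f : holomorphic f.
Proof. by case: f => f /= /asboolP[]. Qed.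

Lemma bloch_out f z : ~ unit_ball X z -> f z = 0.
Proof. by case: f => f /= /asboolP[_ + _]; exact. Qed.

Lemma bloch_has_sup f : has_sup (bloch_values mu f).
Proof.
split; last by case: f => f /= /asboolP[].
by eexists; exists 0 => //; exact: unit_ball0.
Qed.

Lemma bloch_sup_ub f : ubound (bloch_values mu f) (sup (bloch_values mu f)).
Proof. by move=> x; apply: ub_le_sup; case: (bloch_has_sup f). Qed.

Lemma bloch_sup_ge0 f : 0 <= sup (bloch_values mu f).
Proof.
apply: le_trans (bloch_sup_ub (f := f) (ex_intro2 _ _ 0 (unit_ball0 X) erefl)).
by rewrite mulr_ge0 ?rnorm_ge0// ltW// weight_rnorm_gt0//; exact: unit_ball0.
Qed.

Lemma ler_bloch_normD f g : bloch_norm (f + g) <= bloch_norm f + bloch_norm g.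
Proof.
rewrite -rmorphD/= lecR addrACA lerD//; first exact: ler_rnormD.
apply: ge_sup; first by case: (bloch_has_sup (f + g)).
apply: bloch_values_ubD; [exact: bloch_holomorphic..| |]; exact: bloch_sup_ub.
Qed.

Lemma bloch_sup_leZ (l : R[i]) f :
  sup (bloch_values mu (l *: f)) <= rnorm (l : C) * sup (bloch_values mu f).
Proof.
apply: ge_sup; first by case: (bloch_has_sup (l *: f)).
by apply: bloch_values_ubZ; [exact: bloch_holomorphic | exact: bloch_sup_ub].
Qed.

Lemma bloch_normZ (l : R[i]) f : bloch_norm (l *: f) = `|l| * bloch_norm f.
Proof.
rewrite -[`|l|](rnormE (l : C)) -rmorphM/=; congr (_%:C).
rewrite mulrDr; congr (_ + _); first exact: (rnormZ l (f 0)).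
apply/eqP; rewrite eq_le bloch_sup_leZ andTb.
have [l0|l0] := eqVneq l 0.
  have -> : rnorm (l : C) = 0 by rewrite l0 rnorm0.
  have -> : 0 * sup (bloch_values mu f) = 0 by exact: mul0r.
  exact: bloch_sup_ge0.
rewrite -ler_pdivlMl; last by rewrite lt_neqAle rnorm_ge0 eq_sym rnorm_eq0 l0.
rewrite -{1}[f](scalerK l0) (le_trans (bloch_sup_leZ _ _))//.
rewrite ler_wpM2r ?bloch_sup_ge0// -lecR fmorphV/= !rnormE.
by rewrite normfV.
Qed.

Lemma bloch_norm_eq0 f : bloch_norm f = 0 -> f = 0.
Proof.
move=> /complexI/eqP; rewrite paddr_eq0 ?rnorm_ge0 ?bloch_sup_ge0//.
rewrite rnorm_eq0 => /andP[/eqP f0 /eqP s0]; apply/val_inj/funext => z /=.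
have [z1|/bloch_out//] := pselect (unit_ball X z).
rewrite (@ray_cst _ _ f)// => [|w w1]; first exact: bloch_holomorphic.
have := bloch_sup_ub (f := f) (ex_intro2 _ _ w w1 erefl).
rewrite s0 pmulr_rle0 ?weight_rnorm_gt0// => rw.
by apply/eqP; rewrite -rnorm_eq0 eq_le rw rnorm_ge0.
Qed.

HB.instance Definition _ := Lmodule_isNormed.Build R[i] (bloch X mu)
  ler_bloch_normD bloch_normZ bloch_norm_eq0.

End bloch_norm.

Definition compact_operator {K : numFieldType} {U V : normedModType K}
    (T : {linear U -> V}) : Prop :=
  forall A : set U, bounded_set A -> precompact (T @` A).

(* Main.v *)
(* Testing on the functions f_y = dot _ y restricted to the ball, whose Bloch *)
(* norms are bounded for |y| <= 1, compactness of W gives a finite net for     *)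
(* the functions psi * dot (phi _) y in the Bloch norm. This norm dominates    *)
(* the sup norm on smaller balls, so near a point where psi does not vanish    *)
(* the functions dot (phi _) y themselves have a finite sup-norm net. By a     *)
(* two-constants estimate, repeated along a chain of balls, a bounded          *)
(* holomorphic function that is small on one ball is small on r B, with a      *)
(* uniform bound; so the net is also a net on r B, and since                   *)
(* |x| = sup_(|y| <= 1) |dot x y|, this makes phi (r B) totally bounded.       *)
(*                                                                            *)
(* The only complex analysis needed is a bound |f a| <= 2 max |f| of f at the  *)
(* centre of a square by its values away from the centre. It comes from        *)
(* Cauchy's formula with trapezoidal sums in place of integrals: these are     *)
(* exact on affine functions and additive under bisection, which is all that   *)
(* Goursat's argument uses, and no continuity of the derivative is required.   *)

Require Import Defs.
From HB Require Import structures.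
From mathcomp Require Import all_boot all_order all_algebra.
From mathcomp Require Import sesquilinear complex.
From mathcomp Require Import all_classical all_reals all_analysis.
From mathcomp Require Import ring lra.

Set Implicit Arguments.
Unset Strict Implicit.
Unset Printing Implicit Defensive.

Import Order.TTheory GRing.Theory Num.Theory.
Import numFieldNormedType.Exports.

Local Open Scope classical_set_scope.
Local Open Scope complex_scope.
Local Open Scope ring_scope.

(** * Complex norms and trapezoidal sums *)

(** Compactness of [W] gives a net in a Bloch norm, whereas a net for the image of [phi] in [X] is
    wanted. [bloch_growth] first turns Bloch distance into uniform distance on smaller balls.
    Division by [psi] is possible only near a point [z0] with [psi z0 != 0], so it gives smallness
    of [dot (phi _) (y - y')] only on a ball about [z0]. [small_propagates] carries this to the
    whole ball of radius [r], with a threshold [eta] independent of the function; hence the net can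
    be fixed before [y]. Finally [precompact_dot] is a duality step in the manner of Schauder's
    theorem: if the unit ball of functionals is totally bounded for the sup norm on [A], then [A] is
    precompact.

    The analysis of one variable runs from [goursat] through [goursat_corner], which admits the
    difference quotient at the centre, to [cauchy_estimate]. That estimate serves twice: in
    [two_constants_disc], the source of propagation, and in [bloch_growth]. Every passage from local
    to global rests on [square_bisection]. *)

Local Notation cnorm z := (rnorm (z : _[i]^o)).

Section complex_norm.
Variable R : realType.
Implicit Types (z w : R[i]).

Lemma cnormM z w : cnorm (z * w) = cnorm z * cnorm w.
Proof. exact: (rnormZ z (w : R[i]^o)). Qed.

Lemma cnormR (t : R) : cnorm t%:C = `|t|.
Proof. by rewrite /rnorm normc_def/= expr0n addr0 sqrtr_sqr. Qed.

Lemma cnormi : cnorm ('i%C : R[i]) = 1.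
Proof. by rewrite /rnorm normc_def/= expr0n expr1n add0r sqrtr1. Qed.

Lemma rnormN (V : normedModType R[i]) (x : V) : rnorm (- x) = rnorm x.
Proof. by rewrite /rnorm normrN. Qed.

Lemma ler_rnormB (V : normedModType R[i]) (x y : V) :
  rnorm (x - y) <= rnorm x + rnorm y.
Proof. by rewrite (le_trans (ler_rnormD _ _))// rnormN. Qed.

Lemma rnormB_sym (V : normedModType R[i]) (x y : V) :
  rnorm (x - y) = rnorm (y - x).
Proof. by rewrite -opprB rnormN. Qed.

Lemma cnorm1 : cnorm (1 : R[i]) = 1.
Proof. by rewrite (cnormR 1) normr1. Qed.

Lemma cnorm0 : cnorm (0 : R[i]) = 0.
Proof. exact: rnorm0. Qed.

Lemma cnormV z : cnorm z^-1 = (cnorm z)^-1.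
Proof. by apply: complexI; rewrite fmorphV/= !rnormE normfV. Qed.

Lemma cnormX z n : cnorm (z ^+ n) = cnorm z ^+ n.
Proof. by elim: n => [|n IH]; rewrite ?expr0 ?cnorm1// !exprS cnormM IH. Qed.

Lemma cnorm_gt0 z : (0 < cnorm z) = (z != 0).
Proof. by rewrite lt_neqAle rnorm_ge0 andbT eq_sym rnorm_eq0. Qed.

Lemma cnorm_sqr z : cnorm z ^+ 2 = complex.Re z ^+ 2 + complex.Im z ^+ 2.
Proof. by rewrite /rnorm normc_def/= sqr_sqrtr// addr_ge0// sqr_ge0. Qed.

Lemma ler_Re_cnorm z : `|complex.Re z| <= cnorm z.
Proof. by rewrite -lecR rnormE; exact: normc_ge_Re. Qed.

Lemma ler_Im_cnorm z : `|complex.Im z| <= cnorm z.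
Proof.
by rewrite -(@ler_pXn2r _ 2) ?nnegrE ?rnorm_ge0// cnorm_sqr real_normK ?num_real// lerDr sqr_ge0.
Qed.

Lemma ler_cnorm_ReIm z : cnorm z <= `|complex.Re z| + `|complex.Im z|.
Proof.
rewrite -(@ler_pXn2r _ 2) ?nnegrE ?rnorm_ge0// ?addr_ge0// cnorm_sqr sqrrD.
by rewrite !real_normK ?num_real// lerD2r lerDl mulrn_wge0// mulr_ge0.
Qed.

Lemma ler_cnorm_sum (I : Type) (r : seq I) (F : I -> R[i]) :
  cnorm (\sum_(i <- r) F i) <= \sum_(i <- r) cnorm (F i).
Proof.
elim/big_ind2: _ => [|x a y b xa yb|//]; first by rewrite cnorm0.
by rewrite (le_trans (ler_rnormD _ _))// lerD.
Qed.

End complex_norm.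

Section trapezoid.
Variable R : realType.
Implicit Types (f g : R[i] -> R[i]) (p d o z : R[i]) (s : R) (M : nat).

(** The composite trapezoidal rule with [M] pieces for the integral of [f] along the segment from
    [p] to [p + d]. *)
Definition edge f p d M : R[i] := \sum_(l < M)
  d / M%:R / 2 * (f (p + l%:R / M%:R * d) + f (p + l.+1%:R / M%:R * d)).

(* Trapezoidal sum of the integral of [f] along the boundary of the square    *)
(* with lower left corner [o] and side [s].                                   *)
Definition contour f o s M : R[i] :=
  edge f o s%:C M + edge f (o + s%:C) ('i%C * s%:C) M
  - edge f (o + 'i%C * s%:C) s%:C M - edge f o ('i%C * s%:C) M.

Lemma edgeD f g p d M :
  edge (fun z => f z + g z) p d M = edge f p d M + edge g p d M.
Proof. by rewrite -big_split/=; apply: eq_bigr => l _; ring. Qed.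

Lemma edgeZ (a : R[i]) f p d M : edge (fun z => a * f z) p d M = a * edge f p d M.
Proof. by rewrite mulr_sumr; apply: eq_bigr => l _; ring. Qed.

Lemma contourD f g o s M :
  contour (fun z => f z + g z) o s M = contour f o s M + contour g o s M.
Proof. by rewrite /contour !edgeD; ring. Qed.

Lemma contourZ (a : R[i]) f o s M :
  contour (fun z => a * f z) o s M = a * contour f o s M.
Proof. by rewrite /contour !edgeZ; ring. Qed.

(** The nodes of the long sum are exactly those of the two halves, because length and number of
    pieces double together; so there is no error term. *)
Lemma edge_split f p d M : (0 < M)%N ->
  edge f p (2 * d) (M + M) = edge f p d M + edge f (p + d) d M.
Proof.
move=> M0; have M1 : M%:R != 0 :> R[i] by rewrite pnatr_eq0 -lt0n.
rewrite /edge big_split_ord/=; congr (_ + _); apply: eq_bigr => l _.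
  congr (_ * (f _ + f _)); rewrite natrD; field; rewrite M1/= //.
  by rewrite -mulr2n mulrn_eq0.
  by rewrite -mulr2n mulrn_eq0.
  by rewrite -mulr2n mulrn_eq0.
congr (_ * (f _ + f _)); rewrite ?(natrD, =^~natr1); field; rewrite M1/= //.
  by rewrite -mulr2n mulrn_eq0.
  by rewrite -mulr2n mulrn_eq0.
  by rewrite -mulr2n mulrn_eq0.
Qed.

Lemma edge_affine (a b p d : R[i]) M : (0 < M)%N ->
  edge (fun z => a * z + b) p d M = d * (a * (p + d / 2) + b).
Proof.
move=> M0; have M1 : M%:R != 0 :> R[i] by rewrite pnatr_eq0 -lt0n.
(* The partial sums are the exact integrals from [p] to [p + k / M * d], a form that passes through
   induction. *)
have H k : \sum_(l < k)
   d / M%:R / 2 * (a * (p + l%:R / M%:R * d) + b + (a * (p + l.+1%:R / M%:R * d) + b))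
   = d * (k%:R / M%:R) * (a * (p + k%:R / M%:R * d / 2) + b).
  elim: k => [|k IH]; first by rewrite big_ord0 !mul0r mulr0 mul0r.
  by rewrite big_ord_recr/= IH -natr1; field.
by rewrite /edge H; field.
Qed.

Lemma contour_affine (a b o : R[i]) s M : (0 < M)%N ->
  contour (fun z => a * z + b) o s M = 0.
Proof.
by move=> M0; rewrite /contour !edge_affine//; field.
Qed.

(** Each inner edge occurs twice with opposite signs and with the same nodes. *)
Lemma contour_split f o s M : (0 < M)%N ->
  contour f o (s + s) (M + M) =
  contour f o s M + contour f (o + s%:C) s M
  + (contour f (o + 'i%C * s%:C) s M + contour f (o + s%:C + 'i%C * s%:C) s M).
Proof.
move=> M0; rewrite /contour.
have -> : (s + s)%:C = 2 * s%:C :> R[i] by rewrite rmorphD/= mulr_natl mulr2n.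
rewrite !(mulrCA 'i%C 2) !edge_split//.
have -> : o + 2 * s%:C = o + s%:C + s%:C by ring.
have -> : o + 2 * ('i%C * s%:C) = o + 'i%C * s%:C + 'i%C * s%:C by ring.
have -> : o + s%:C + s%:C + 'i%C * s%:C = o + s%:C + 'i%C * s%:C + s%:C by ring.
have -> : o + 'i%C * s%:C + s%:C = o + s%:C + 'i%C * s%:C by ring.
have -> : o + 'i%C * s%:C + 'i%C * s%:C + s%:C =
  o + s%:C + 'i%C * s%:C + 'i%C * s%:C by ring.
ring.
Qed.

Lemma edge_bound f p d M (m : R) : (0 < M)%N ->
  (forall t : R, 0 <= t <= 1 -> cnorm (f (p + t%:C * d)) <= m) ->
  cnorm (edge f p d M) <= cnorm d * m.
Proof.
move=> M0 H; have M1 : (0 : R) < M%:R by rewrite ltr0n.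
have MC : (M%:R : R)%:C = M%:R :> R[i] by rewrite rmorph_nat.
have {}H l : (l <= M)%N -> cnorm (f (p + l%:R / M%:R * d)) <= m.
  move=> lM; have -> : l%:R / M%:R = (l%:R / M%:R)%:C :> R[i].
    by rewrite rmorphM/= fmorphV/= !rmorph_nat.
  by apply: H; rewrite divr_ge0// ler_pdivrMr// mul1r ler_nat.
rewrite (le_trans (ler_cnorm_sum _ _))//.
rewrite (@le_trans _ _ (\sum_(l < M) cnorm d * m / M%:R))//; last first.
  by rewrite sumr_const card_ord -[X in X <= _]mulr_natl mulrC divfK// gt_eqF.
apply: ler_sum => l _; rewrite !cnormM !cnormV.
have -> : cnorm (M%:R : R[i]) = M%:R by rewrite -MC cnormR normr_nat.
have -> : cnorm (2 : R[i]) = 2 by rewrite -(rmorph_nat (real_complex R) 2) cnormR normr_nat.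
have := H l (ltnW (ltn_ord l)); have := H l.+1 (ltn_ord l) => H1 H2.
have -> : cnorm d * m / M%:R = cnorm d / M%:R / 2 * (m + m) by field; rewrite gt_eqF.
rewrite ler_wpM2l ?divr_ge0 ?rnorm_ge0 ?(ltW M1)//.
by rewrite (le_trans (ler_rnormD _ _))// lerD.
Qed.

Definition square o s z := (complex.Re o <= complex.Re z <= complex.Re o + s) /\
  (complex.Im o <= complex.Im z <= complex.Im o + s).

Definition square_boundary o s z := square o s z /\
  [\/ complex.Re z = complex.Re o, complex.Re z = complex.Re o + s,
      complex.Im z = complex.Im o | complex.Im z = complex.Im o + s].

Lemma contour_bound f o s M (m : R) : (0 < M)%N -> 0 <= s ->
  (forall z, square_boundary o s z -> cnorm (f z) <= m) ->
  cnorm (contour f o s M) <= 4 * s * m.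
Proof.
move=> M0 s0 H; rewrite /contour.
have cs : cnorm (s%:C : R[i]) = s by rewrite cnormR ger0_norm.
have cis : cnorm ('i%C * s%:C : R[i]) = s by rewrite cnormM cnormi mul1r.
have E1 : cnorm (edge f o s%:C M) <= s * m.
  rewrite -{2}cs; apply: edge_bound => // t /andP[t0 t1]; apply: H.
  case: o => x y; rewrite /square_boundary /square/=; simpc.
  have ts : 0 <= t * s <= s by rewrite mulr_ge0// ler_piMl.
  by split; [lra|constructor 3; lra].
have E2 : cnorm (edge f (o + s%:C) ('i%C * s%:C) M) <= s * m.
  rewrite -{3}cis; apply: edge_bound => // t /andP[t0 t1]; apply: H.
  case: o {E1} => x y; rewrite /square_boundary /square/=; simpc.
  have ts : 0 <= t * s <= s by rewrite mulr_ge0// ler_piMl.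
  by split; [lra|constructor 2; lra].
have E3 : cnorm (edge f (o + 'i%C * s%:C) s%:C M) <= s * m.
  rewrite -{3}cs; apply: edge_bound => // t /andP[t0 t1]; apply: H.
  case: o {E1 E2} => x y; rewrite /square_boundary /square/=; simpc.
  have ts : 0 <= t * s <= s by rewrite mulr_ge0// ler_piMl.
  by split; [lra|constructor 4; lra].
have E4 : cnorm (edge f o ('i%C * s%:C) M) <= s * m.
  rewrite -{2}cis; apply: edge_bound => // t /andP[t0 t1]; apply: H.
  case: o {E1 E2 E3} => x y; rewrite /square_boundary /square/=; simpc.
  have ts : 0 <= t * s <= s by rewrite mulr_ge0// ler_piMl.
  by split; [lra|constructor 1; lra].
move: E1 E2 E3 E4.
set e1 := edge _ _ _ _; set e2 := edge _ _ _ _; set e3 := edge _ _ _ _; set e4 := edge _ _ _ _.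
have := ler_rnormB (e1 + e2 - e3 : R[i]^o) e4.
have := ler_rnormB (e1 + e2 : R[i]^o) e3.
have := ler_rnormD (e1 : R[i]^o) e2.
by move=> /=; lra.
Qed.

End trapezoid.

(** * Goursat's theorem *)

Section halving.
Variable R : realType.

Lemma exists_half_lt (x d : R) : 0 < d -> exists k : nat, x / 2 ^+ k < d.
Proof.
move=> d0; have [x0|x0] := leP x 0.
  by exists 0%N; rewrite expr0 divr1 (le_lt_trans x0).
have /archi_boundP : 0 <= x / d by rewrite divr_ge0// ltW.
set k := Num.bound _ => kP; exists k.
rewrite ltr_pdivrMr ?exprn_gt0// mulrC -ltr_pdivrMr//.
by rewrite (lt_trans kP)// -natrX ltr_nat ltn_expl.
Qed.

Lemma nested_halves (a : nat -> R) (s : R) : 0 <= s ->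
  (forall k, a k <= a k.+1 /\ a k.+1 + s / 2 ^+ k.+1 <= a k + s / 2 ^+ k) ->
  exists x, forall k, a k <= x <= a k + s / 2 ^+ k.
Proof.
move=> s0 H.
have sk k : 0 <= s / 2 ^+ k by rewrite divr_ge0// exprn_ge0.
have up k n : a k <= a (k + n)%N.
  by elim: n => [|n IH]; rewrite ?addn0// addnS (le_trans IH)//; case: (H (k + n)%N).
have dn k n : a (k + n)%N + s / 2 ^+ (k + n) <= a k + s / 2 ^+ k.
  by elim: n => [|n IH]; rewrite ?addn0// addnS (le_trans _ IH)//; case: (H (k + n)%N).
have ub j k : a j <= a k + s / 2 ^+ k.
  rewrite (le_trans (up j k))// (le_trans _ (dn k j))// addnC lerDl//.
have hs : has_sup (range a).
  by split; [exists (a 0%N), 0%N | exists (a 0%N + s / 2 ^+ 0) => _ [j _ <-]].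
exists (sup (range a)) => k; apply/andP; split.
  by apply: ub_le_sup; [case: hs | exists k].
by apply: ge_sup; [case: hs | move=> _ [j _ <-]].
Qed.

Lemma nested_squares (P : nat -> R[i] -> Prop) (o : R[i]) (s : R) : 0 <= s ->
  P 0%N o ->
  (forall k o1, P k o1 -> exists2 o2, P k.+1 o2 & exists c d : bool,
      o2 = o1 + (c%:R * (s / 2 ^+ k.+1))%:C + 'i%C * (d%:R * (s / 2 ^+ k.+1))%:C) ->
  exists z, forall k, exists2 o1, P k o1 & square o1 (s / 2 ^+ k) z.
Proof.
move=> s0 P0 HP.
have /boolp.choice[nx nxP] : forall ko : nat * R[i], exists o2 : R[i], P ko.1 ko.2 ->
    P ko.1.+1 o2 /\ exists c d : bool,
      o2 = ko.2 + (c%:R * (s / 2 ^+ ko.1.+1))%:C + 'i%C * (d%:R * (s / 2 ^+ ko.1.+1))%:C.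
  (* Choice needs a total relation; where [P] fails, 0 is a dummy value. *)
  move=> [k o1] /=; have [kP|nP] := pselect (P k o1); last by exists 0.
  by have [q p2 c2] := HP _ _ kP; exists q.
pose u := fix u k := if k is k'.+1 then nx (k', u k') else o.
have Pu k : P k (u k) by elim: k => // k IH; case: (nxP (k, u k) IH).
have hE k : s / 2 ^+ k = s / 2 ^+ k.+1 + s / 2 ^+ k.+1.
  by rewrite exprS; field; rewrite expf_neq0.
have h0 k : 0 <= s / 2 ^+ k by rewrite divr_ge0// exprn_ge0.
have st k : (complex.Re (u k) <= complex.Re (u k.+1) /\
     complex.Re (u k.+1) + s / 2 ^+ k.+1 <= complex.Re (u k) + s / 2 ^+ k) /\
   (complex.Im (u k) <= complex.Im (u k.+1) /\
     complex.Im (u k.+1) + s / 2 ^+ k.+1 <= complex.Im (u k) + s / 2 ^+ k).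
  have [_ [c [d /= ->]]] := nxP (k, u k) (Pu k).
  rewrite (hE k); have := h0 k.+1; move: (s / _) => h h'.
  by case: (u k) => x y; case: c; case: d => /=; simpc => /=; lra.
have [x xP] := nested_halves s0 (fun k => (st k).1).
have [y yP] := nested_halves s0 (fun k => (st k).2).
by exists (x +i* y) => k; exists (u k) => //; split => /=.
Qed.

Lemma square_dist (o z w : R[i]) (s : R) :
  square o s z -> square o s w -> cnorm (w - z) <= 2 * s.
Proof.
move=> zs ws; rewrite (le_trans (ler_cnorm_ReIm _))//.
move: zs ws; rewrite /square; case: w => wx wy; case: z => zx zy /=.
move=> [z1 z2] [w1 w2].
have : `|wx - zx| <= s by rewrite ler_norml; lra.
have : `|wy - zy| <= s by rewrite ler_norml; lra.
lra.
Qed.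

(** A defect that always passes to some quarter of a square concentrates at a point. It is applied
    to excess of contour sums, to unboundedness and to excess slope. The booleans [c] and [d] select
    the quarter. *)
Lemma square_bisection (A : R[i] -> R -> Prop) (o : R[i]) (s : R) :
  0 < s -> A o s ->
  (forall q h, 0 < h -> A q (h + h) ->
     exists c d : bool, A (q + (c%:R * h)%:C + 'i%C * (d%:R * h)%:C) h) ->
  exists2 p, square o s p & forall d : R, 0 < d -> exists q h,
    [/\ 0 < h, h < d, square q h p, forall z, square q h z -> square o s z & A q h].
Proof.
move=> s0 As Asplit; pose h k : R := s / 2 ^+ k.
have hS k : h k = h k.+1 + h k.+1 by rewrite /h exprS; field; rewrite expf_neq0.
have h0 k : 0 < h k by rewrite divr_gt0// exprn_gt0.
have hs : h 0%N = s by rewrite /h expr0 divr1.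
pose P k q := (forall z, square q (h k) z -> square o s z) /\ A q (h k).
have P0 : P 0%N o by split; rewrite hs.
have Pstep k q : P k q -> exists2 q', P k.+1 q' & exists c d : bool,
    q' = q + (c%:R * (s / 2 ^+ k.+1))%:C + 'i%C * (d%:R * (s / 2 ^+ k.+1))%:C.
  rewrite /P hS => -[sub /(Asplit _ _ (h0 _))[c [d Acd]]].
  eexists; last by exists c, d.
  split=> // z; rewrite -/(h k.+1); move: {Acd} (h k.+1) (h0 k.+1) (sub z) => t t0; rewrite /square.
  case: (z) => zx zy; case: (q) => x y.
  by case: c; case: d => /=; simpc => /= H [H1 H2]; apply: H; lra.
have [p pP] := nested_squares (ltW s0) P0 Pstep.
exists p; first by have [q [sub _]] := pP 0%N; exact: sub.
move=> d d0; have [k kd] := exists_half_lt s d0.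
by have [q [sub Aq] qp] := pP k; exists q, (h k).
Qed.

End halving.

Section complex_derivative.
Variable R : realType.
Implicit Types (f g : R[i] -> R[i]) (a c o z : R[i]) (s : R).

Definition is_cderiv f z c := forall e : R, 0 < e -> exists2 d : R, 0 < d &
  forall h, cnorm h < d -> cnorm (f (z + h) - f z - c * h) <= e * cnorm h.

Definition cdiff f z := exists c, is_cderiv f z c.

Lemma cdiffBc f a z : cdiff f z -> cdiff (fun w => f w - a) z.
Proof.
move=> [c fc]; exists c => e /fc[d d0 H]; exists d => // h /H.
by congr (rnorm _ <= _); rewrite /=; ring.
Qed.

Lemma cdiff_divB f a z : z != a -> cdiff f z -> cdiff (fun w => f w / (w - a)) z.
Proof.
move=> za [c fc]; set u := z - a.
have u0 : u != 0 by rewrite subr_eq0.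
have Nu : 0 < cnorm u by rewrite cnorm_gt0.
pose k := cnorm ((c * u - f z) / u ^+ 2).
have k0 : 0 <= k by exact: rnorm_ge0.
exists ((c * u - f z) / u ^+ 2) => e e0.
have [d d0 H] := fc (e / 4 * cnorm u) (mulr_gt0 (divr_gt0 e0 (ltr0n _ 4)) Nu).
(* The three radii keep [h] within reach of [fc], keep [u + h] at least half as large as [u], and
   make the quadratic error at most [e / 4 * cnorm u * cnorm h]. *)
exists (Num.min d (Num.min (cnorm u / 2) (e / (4 * (k + 1)) * cnorm u))).
  by rewrite !lt_min d0/= divr_gt0//= mulr_gt0// divr_gt0// mulr_gt0//; lra.
move=> h; rewrite !lt_min => /and3P[hd hu he].
have Nuh : cnorm u / 2 <= cnorm (u + h).
  have := ler_rnormB (u + h : R[i]^o) h; rewrite addrK; lra.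
have uh0 : u + h != 0 by rewrite -cnorm_gt0; lra.
have -> : f (z + h) / (z + h - a) - f z / u - (c * u - f z) / u ^+ 2 * h =
  (f (z + h) - f z - c * h - (c * u - f z) / u ^+ 2 * h * h) / (u + h).
  have -> : z + h - a = u + h by rewrite /u; ring.
  by field; rewrite u0 uh0.
have Nuh0 : 0 < cnorm (u + h) by rewrite cnorm_gt0.
rewrite cnormM cnormV ler_pdivrMr//.
rewrite (le_trans (ler_rnormB _ _))// 2!cnormM -/k.
have N0 : 0 <= cnorm h := rnorm_ge0 _.
have H1 := H h hd.
have H2 : k * cnorm h <= e / 4 * cnorm u.
  have : cnorm h <= e / (4 * (k + 1)) * cnorm u by exact: ltW.
  move=> /(ler_wpM2l k0) /le_trans; apply.
  rewrite mulrA ler_wpM2r ?(ltW Nu)//.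
  have -> : k * (e / (4 * (k + 1))) = e / 4 * (k / (k + 1)) by field; lra.
  by rewrite ler_piMr ?divr_ge0 ?(ltW e0)// ler_pdivrMr; lra.
have H3 : k * cnorm h * cnorm h <= e / 4 * cnorm u * cnorm h by rewrite ler_wpM2r.
have H4 : e * cnorm h * (cnorm u / 2) <= e * cnorm h * cnorm (u + h).
  by rewrite ler_wpM2l// mulr_ge0// ltW.
lra.
Qed.

(** This stands for a vanishing contour integral. Powers of two suffice and fit [contour_split],
    which doubles the number of pieces. *)
Definition contour_small f o s := forall e : R, 0 < e -> exists N, forall n,
  (N <= n)%N -> cnorm (contour f o s (2 ^ n)) <= e.

Lemma contour_split_pow f o s n :
  contour f o (s + s) (2 ^ n.+1) =
  contour f o s (2 ^ n) + contour f (o + s%:C) s (2 ^ n)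
  + (contour f (o + 'i%C * s%:C) s (2 ^ n) +
     contour f (o + s%:C + 'i%C * s%:C) s (2 ^ n)).
Proof. by rewrite expnS mul2n -addnn contour_split// expn_gt0. Qed.

Lemma contour_split_le f o s (e1 e2 e3 e4 : R) :
  let le o e := exists N, forall n, (N <= n)%N -> cnorm (contour f o s (2 ^ n)) <= e in
  le o e1 -> le (o + s%:C) e2 -> le (o + 'i%C * s%:C) e3 ->
  le (o + s%:C + 'i%C * s%:C) e4 ->
  exists N, forall n, (N <= n)%N ->
    cnorm (contour f o (s + s) (2 ^ n)) <= e1 + e2 + (e3 + e4).
Proof.
move=> le [N1 H1] [N2 H2] [N3 H3] [N4 H4].
exists (maxn (maxn N1 N2) (maxn N3 N4)).+1 => -[//|n].
rewrite ltnS !geq_max => /andP[/andP[n1 n2] /andP[n3 n4]].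
rewrite contour_split_pow (le_trans (ler_rnormD _ _))//.
apply: lerD; apply: le_trans (ler_rnormD _ _) _; apply: lerD;
  by [exact: H1|exact: H2|exact: H3|exact: H4].
Qed.

Lemma contour_small_split f o s :
  contour_small f o s -> contour_small f (o + s%:C) s ->
  contour_small f (o + 'i%C * s%:C) s -> contour_small f (o + s%:C + 'i%C * s%:C) s ->
  contour_small f o (s + s).
Proof.
move=> H1 H2 H3 H4 e e0; have e4 : 0 < e / 4 by rewrite divr_gt0.
have := contour_split_le (H1 _ e4) (H2 _ e4) (H3 _ e4) (H4 _ e4).
by rewrite (_ : _ / 4 + _ + _ = e)//; field.
Qed.

Lemma goursat f o s : 0 < s -> (forall z, square o s z -> cdiff f z) ->
  contour_small f o s.
Proof.
move=> s0 fd; apply: contrapT => /existsNP[e /not_implyP[e0 /forallNP bad]].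
(* The threshold scales like area, so four quarters that all obey it make the whole square obey
   it. *)
pose A q h := forall N, exists2 n, (N <= n)%N &
  e * (h / s) ^+ 2 < cnorm (contour f q h (2 ^ n)).
have notA q h : ~ A q h -> exists N, forall n, (N <= n)%N ->
    cnorm (contour f q h (2 ^ n)) <= e * (h / s) ^+ 2.
  move=> /existsNP[N HN]; exists N => n Nn; rewrite leNgt; apply/negP => ?.
  by apply: HN; exists n.
have As : A o s.
  move=> N; have /existsNP[n /not_implyP[Nn /negP]] := bad N.
  by rewrite -ltNge => ?; exists n; rewrite // divff ?gt_eqF// expr1n mulr1.
have Asplit q h : 0 < h -> A q (h + h) ->
    exists c d : bool, A (q + (c%:R * h)%:C + 'i%C * (d%:R * h)%:C) h.
  move=> h0 fr; apply: contrapT => noA.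
  have ch (c d : bool) := notA _ _ (fun Ac => noA (ex_intro _ c (ex_intro _ d Ac))).
  have := ch false false; rewrite !mul0r mulr0 !addr0 => H1.
  have := ch true false; rewrite mul0r mul1r mulr0 addr0 => H2.
  have := ch false true; rewrite mul0r mul1r addr0 => H3.
  have := ch true true; rewrite !mul1r => H4.
  have [N HN] := contour_split_le H1 H2 H3 H4.
  have [n /HN] := fr N; set x := cnorm _.
  rewrite (_ : _ * _ + _ + _ = e * ((h + h) / s) ^+ 2); last by field; rewrite gt_eqF.
  by move=> xle /lt_le_trans/(_ xle); rewrite ltxx.
have [p sp pP] := square_bisection s0 As Asplit.
have [c fc] := fd p sp.
(* Near [p], [f] is affine up to a remainder, and the affine part has contour sum 0. The remainder
   contributes at most the perimeter [4 * h] times this constant times the diameter bound [2 * h],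
   which is exactly the threshold. *)
have e1 : 0 < e / (8 * s ^+ 2) by rewrite divr_gt0// mulr_gt0// exprn_gt0.
have [d d0 Hd] := fc _ e1.
have [q [h [h0 hd qp _ fr]]] := pP _ (divr_gt0 d0 (ltr0n _ 2)).
have [n _] := fr 0%N; apply/negP; rewrite -leNgt.
pose r z := f z - f p - c * (z - p).
have -> : f = fun z => (c * z + (f p - c * p)) + r z.
  by apply/funext => z; rewrite /r; ring.
rewrite contourD contour_affine ?expn_gt0// add0r.
have -> : e * (h / s) ^+ 2 = 4 * h * (e / (8 * s ^+ 2) * (2 * h)).
  by field; rewrite gt_eqF.
apply: contour_bound; rewrite ?expn_gt0 ?(ltW h0)// => z [zq _].
have zp := square_dist qp zq.
have zd : cnorm (z - p) < d by lra.
have := Hd _ zd; rewrite [p + _]addrC subrK => /le_trans; apply.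
by rewrite ler_wpM2l// ltW.
Qed.

(** Unboundedness would concentrate at a point, where differentiability makes [f] locally
    bounded. *)
Lemma cdiff_bounded f o s : 0 < s -> (forall z, square o s z -> cdiff f z) ->
  exists k, forall z, square o s z -> cnorm (f z) <= k.
Proof.
move=> s0 fd; apply: contrapT => unb.
pose A q h := ~ exists k, forall z, square q h z -> cnorm (f z) <= k.
have Asplit q h : 0 < h -> A q (h + h) ->
    exists c d : bool, A (q + (c%:R * h)%:C + 'i%C * (d%:R * h)%:C) h.
  move=> h0 Aq; apply: contrapT => noA; apply: Aq.
  have ch (c d : bool) := contrapT (fun Ac => noA (ex_intro _ c (ex_intro _ d Ac))).
  have [k1 H1] := ch false false; have [k2 H2] := ch true false.
  have [k3 H3] := ch false true; have [k4 H4] := ch true true.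
  exists (Num.max (Num.max k1 k2) (Num.max k3 k4)) => z; rewrite !le_max.
  move: (H1 z) (H2 z) (H3 z) (H4 z); rewrite /square {H1 H2 H3 H4 ch}.
  case: (z) => zx zy; case: (q) => x y /=; simpc => /= H1 H2 H3 H4 [zx1 zy1].
  have [xl|xl] := leP zx (x + h); have [yl|yl] := leP zy (y + h).
  - by rewrite H1//; split; lra.
  - by rewrite H3 ?orbT//; split; lra.
  - by rewrite H2 ?orbT//; split; lra.
  - by rewrite H4 ?orbT//; split; lra.
have [p sp pP] := square_bisection s0 unb Asplit.
have [c fc] := fd p sp; have [d d0 Hd] := fc 1 ltr01.
have [q [h [h0 hd qp _]]] := pP _ (divr_gt0 d0 (ltr0n _ 2)); apply.
exists (cnorm (f p) + (1 + cnorm c) * d) => z zq.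
have zp := square_dist qp zq.
have zd : cnorm (z - p) < d by lra.
have := Hd _ zd; rewrite [p + _]addrC subrK => H.
have -> : f z = f p + ((f z - f p - c * (z - p)) + c * (z - p)) by ring.
rewrite (le_trans (ler_rnormD _ _))// lerD2l (le_trans (ler_rnormD _ _))//.
rewrite mulrDl lerD//; first by rewrite (le_trans H)// ler_wpM2l// ltW.
by rewrite cnormM ler_wpM2l ?rnorm_ge0// ltW.
Qed.

(** Bisect [k] times towards the corner. Quarters that miss it fall under [goursat]; the remaining
    square has side [s / 2 ^+ k], where the bound [m] alone gives a small contour sum. *)
Lemma goursat_corner f o s m (c d : bool) : 0 < s ->
  let a := o + (c%:R * s)%:C + 'i%C * (d%:R * s)%:C in
  (forall z, square o s z -> z != a -> cdiff f z) ->
  (forall z, square o s z -> cnorm (f z) <= m) ->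
  contour_small f o s.
Proof.
move=> s0 a fd fm.
suff H k e : 0 < e -> exists N, forall n, (N <= n)%N ->
    cnorm (contour f o s (2 ^ n)) <= 4 * s * m / 2 ^+ k + e.
  move=> e e0; have [k kP] := exists_half_lt (4 * s * m) (divr_gt0 e0 (ltr0n _ 2)).
  have [N HN] := H k (e / 2) (divr_gt0 e0 (ltr0n _ 2)); exists N => n /HN; lra.
elim: k e o s @a s0 fd fm => [|k IH] e o1 s1 a s0 fd fm e0.
  exists 0%N => n _; apply: (@le_trans _ _ (4 * s1 * m)); last by rewrite expr0; lra.
  by apply: contour_bound; rewrite ?expn_gt0 ?(ltW s0)// => z [/fm].
pose h := s1 / 2; have sE : s1 = h + h by rewrite /h; field.
have h0 : 0 < h by rewrite divr_gt0.
have e4 : 0 < e / 4 by rewrite divr_gt0.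
have sq (x y : bool) z : square (o1 + (x%:R * h)%:C + 'i%C * (y%:R * h)%:C) h z ->
   square o1 s1 z.
  rewrite sE /square; case: (z) => zx zy; case: (o1) => ox oy.
  by case: x; case: y => /=; simpc => /= -[H1 H2]; lra.
have far (x y : bool) : (x, y) != (c, d) ->
    exists N, forall n, (N <= n)%N -> cnorm (contour f
      (o1 + (x%:R * h)%:C + 'i%C * (y%:R * h)%:C) h (2 ^ n)) <= e / 4.
  move=> xy; apply: (goursat h0) (e4) => z zs; apply: fd; first exact: sq zs.
  apply: contraNN xy => /eqP za; move: zs; rewrite za /a sE /square.
  case: (o1) => ox oy.
  by case: (x); case: (y); case: (c); case: (d) => //=; simpc => /= -[H1 H2]; lra.
have near : exists N, forall n, (N <= n)%N -> cnorm (contour f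
      (o1 + (c%:R * h)%:C + 'i%C * (d%:R * h)%:C) h (2 ^ n))
      <= 4 * s1 * m / 2 ^+ k.+1 + e / 4.
  have -> : 4 * s1 * m / 2 ^+ k.+1 = 4 * h * m / 2 ^+ k.
    by rewrite sE exprS; field; rewrite expf_neq0.
  apply: IH => // z zs; last exact: (fm _ (sq _ _ _ zs)).
  move=> za; apply: fd; first exact: sq zs.
  by apply: contraNN za => /eqP ->; apply/eqP; rewrite /a sE !mulrDr !rmorphD/=; ring.
pose b x y : R := if (x, y) == (c, d) then 4 * s1 * m / 2 ^+ k.+1 + e / 4 else e / 4.
have all4 (x y : bool) : exists N, forall n, (N <= n)%N -> cnorm (contour f
      (o1 + (x%:R * h)%:C + 'i%C * (y%:R * h)%:C) h (2 ^ n)) <= b x y.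
  rewrite /b; case: eqP => [[-> ->]//|/eqP]; exact: far.
have := all4 false false; rewrite !mul0r mulr0 !addr0 => H1.
have := all4 true false; rewrite mul0r mul1r mulr0 addr0 => H2.
have := all4 false true; rewrite mul0r mul1r addr0 => H3.
have := all4 true true; rewrite !mul1r => H4.
have := contour_split_le H1 H2 H3 H4; rewrite -sE.
rewrite (_ : b _ _ + _ + _ = 4 * s1 * m / 2 ^+ k.+1 + e)//.
rewrite /b !xpair_eqE; case: (c); case: (d) => /=; field; rewrite expf_neq0//.
Qed.

End complex_derivative.

(** * Cauchy's estimate and its consequences *)

Section cauchy_estimate.
Variable R : realType.
Implicit Types (f g : R[i] -> R[i]) (a b c o p d z : R[i]) (s : R).

(** The factor [u] will be 1 or -1, the sign of the edge in [contour]. *)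
Lemma edge_Im_ge f (u : R[i]) p d M (m : R) : (0 < M)%N ->
  (forall t : R, 0 <= t <= 1 -> m <= complex.Im (u * d * f (p + t%:C * d))) ->
  m <= complex.Im (u * edge f p d M).
Proof.
move=> M0 H; have M1 : (0 : R) < M%:R by rewrite ltr0n.
have {}H l : (l <= M)%N -> m <= complex.Im (u * d * f (p + l%:R / M%:R * d)).
  move=> lM; have -> : l%:R / M%:R = (l%:R / M%:R)%:C :> R[i].
    by rewrite rmorphM/= fmorphV/= !rmorph_nat.
  by apply: H; rewrite divr_ge0// ler_pdivrMr// mul1r ler_nat.
have ImZ (t : R) z : complex.Im (t%:C * z) = t * complex.Im z.
  by case: z => x y /=; simpc.
rewrite /edge mulr_sumr raddf_sum.
rewrite (@le_trans _ _ (\sum_(l < M) m / M%:R))//.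
  by rewrite sumr_const card_ord -[X in _ <= X]mulr_natl mulrC divfK// gt_eqF.
apply: ler_sum => l _.
set f1 := f _; set f2 := f _.
have -> : u * (d / M%:R / 2 * (f1 + f2)) =
    (M%:R^-1 / 2 : R)%:C * (u * d * f1 + u * d * f2).
  by rewrite rmorphM/= !fmorphV/= !rmorph_nat; ring.
rewrite /= ImZ raddfD/=.
have -> : m / M%:R = M%:R^-1 / 2 * (m + m) by field; rewrite gt_eqF.
rewrite ler_wpM2l ?divr_ge0 ?invr_ge0 ?(ltW M1)//.
have := H l (ltnW (ltn_ord l)); have := H l.+1 (ltn_ord l).
rewrite -/f1 -/f2; lra.
Qed.

(* The limit is [2 * pi]; each edge contributes [pi / 2 >= 1]. *)
Lemma contour_inv_ge a s M : (0 < M)%N -> 0 < s ->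
  4 <= cnorm (contour (fun z => (z - a)^-1) (a - s%:C - 'i%C * s%:C) (s + s) M).
Proof.
move=> M0 s0; rewrite (le_trans _ (le_trans (ler_norm _) (ler_Im_cnorm _)))//.
rewrite /contour.
(* On each edge, up to orientation, the integrand has imaginary part
   [2 * s * s / (x ^+ 2 + s ^+ 2)], with [x] the offset from the midpoint. *)
have key (x : R) : - s <= x <= s -> 1 <= 2 * s * s / (x ^+ 2 + s ^+ 2).
  move=> xs; rewrite ler_pdivlMr; last by have := sqr_ge0 x; have := exprn_gt0 2 s0; lra.
  have : 0 <= (s - x) * (s + x) by rewrite mulr_ge0; lra.
  nra.
have rng (t : R) : 0 <= t <= 1 -> 0 <= t * s <= s.
  by move=> /andP[t0 t1]; rewrite mulr_ge0 ?(ltW s0)// ler_piMl// ltW.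
have nz (x : R) : x ^+ 2 + s ^+ 2 != 0.
  by rewrite gt_eqF//; have := sqr_ge0 x; have := exprn_gt0 2 s0; lra.
have invE (x y : R) : (x +i* y)^-1 = (x / (x ^+ 2 + y ^+ 2)) +i* (- y / (x ^+ 2 + y ^+ 2)) :> R[i].
  by apply/eqP; rewrite eq_complex/= mulNr !eqxx.
set g := fun z => _; set o := a - _ - _.
have e1 : 1 <= complex.Im (1 * edge g o (s + s)%:C M).
  apply: edge_Im_ge => // t /rng ts; rewrite /g /o.
  have -> : a - s%:C - 'i%C * s%:C + t%:C * (s + s)%:C - a = (2 * (t * s) - s) +i* (- s).
    by case: a {g o} => x y; simpc; apply/eqP; rewrite eq_complex /=; apply/andP; split; apply/eqP; ring.
  have xs : - s <= 2 * (t * s) - s <= s by lra.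
  apply: le_trans (key _ xs) _; have := nz (2 * (t * s) - s).
  move: (2 * _ - s) => x n0; rewrite invE; simpc; rewrite /= sqrrN.
  by rewrite le_eqVlt; apply/orP; left; apply/eqP; field.
have e2 : 1 <= complex.Im (1 * edge g (o + (s + s)%:C) ('i%C * (s + s)%:C) M).
  apply: edge_Im_ge => // t /rng ts; rewrite /g /o.
  have -> : a - s%:C - 'i%C * s%:C + (s + s)%:C + t%:C * ('i%C * (s + s)%:C) - a = s +i* (2 * (t * s) - s).
    by case: a {g o e1} => x y; simpc; apply/eqP; rewrite eq_complex /=; apply/andP; split; apply/eqP; ring.
  have xs : - s <= 2 * (t * s) - s <= s by lra.
  apply: le_trans (key _ xs) _; have := nz (2 * (t * s) - s).
  move: (2 * _ - s) => x n0; rewrite invE; simpc; rewrite /= (addrC (s ^+ 2)).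
  by rewrite le_eqVlt; apply/orP; left; apply/eqP; field.
have e3 : 1 <= complex.Im (-1 * edge g (o + 'i%C * (s + s)%:C) (s + s)%:C M).
  apply: edge_Im_ge => // t /rng ts; rewrite /g /o.
  have -> : a - s%:C - 'i%C * s%:C + 'i%C * (s + s)%:C + t%:C * (s + s)%:C - a = (2 * (t * s) - s) +i* s.
    by case: a {g o e1 e2} => x y; simpc; apply/eqP; rewrite eq_complex /=; apply/andP; split; apply/eqP; ring.
  have xs : - s <= 2 * (t * s) - s <= s by lra.
  apply: le_trans (key _ xs) _; have := nz (2 * (t * s) - s).
  move: (2 * _ - s) => x n0; rewrite invE mulN1r; simpc => /=.
  by rewrite le_eqVlt; apply/orP; left; apply/eqP; field.
have e4 : 1 <= complex.Im (-1 * edge g o ('i%C * (s + s)%:C) M).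
  apply: edge_Im_ge => // t /rng ts; rewrite /g /o.
  have -> : a - s%:C - 'i%C * s%:C + t%:C * ('i%C * (s + s)%:C) - a = (- s) +i* (2 * (t * s) - s).
    by case: a {g o e1 e2 e3} => x y; simpc; apply/eqP; rewrite eq_complex /=; apply/andP; split; apply/eqP; ring.
  have xs : - s <= 2 * (t * s) - s <= s by lra.
  apply: le_trans (key _ xs) _; have := nz (2 * (t * s) - s).
  move: (2 * _ - s) => x n0; rewrite invE mulN1r; simpc; rewrite /= sqrrN (addrC (s ^+ 2)).
  by rewrite le_eqVlt; apply/orP; left; apply/eqP; field.
move: e1 e2 e3 e4; rewrite !mul1r !mulN1r !raddfB !raddfD !raddfN/=; lra.
Qed.

(* A crude form of Cauchy's formula: any constant in place of 2 would do. *)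
Lemma cauchy_estimate f a s (m : R) : 0 < s ->
  let Q := square (a - s%:C - 'i%C * s%:C) (s + s) in
  (forall z, Q z -> cdiff f z) ->
  (forall z, Q z -> s <= cnorm (z - a) -> cnorm (f z) <= m) ->
  cnorm (f a) <= 2 * m.
Proof.
move=> s0 Q fd fm.
have [k fk] : exists k, forall z, Q z -> cnorm (f z) <= k.
  by apply: cdiff_bounded => //; lra.
have QE z : Q z <-> (`|complex.Re (z - a)| <= s /\ `|complex.Im (z - a)| <= s).
  rewrite /Q /square; case: (z) => zx zy; case: (a) => x y; simpc => /=; rewrite !ler_norml.
  by split; lra.
have Qa : Q a by apply/QE; rewrite subrr/= normr0 (ltW s0).
pose G z := (f z - f a) / (z - a).
have Gd z : Q z -> z != a -> cdiff G z.
  by move=> Qz za; apply: cdiff_divB => //; apply: cdiffBc; exact: fd.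
have k0 : 0 <= k by exact: le_trans (rnorm_ge0 _) (fk _ Qa).
(* Near [a] differentiability bounds the quotient; elsewhere the bound [k] on [f] does. *)
have [K GK] : exists K, forall z, Q z -> cnorm (G z) <= K.
  have [c fc] := fd a Qa; have [d d0 H] := fc 1 ltr01.
  exists (Num.max (1 + cnorm c) ((k + k) / d)) => z Qz; rewrite le_max.
  have [za|za] := eqVneq z a.
    by rewrite /G za !subrr mul0r cnorm0 addr_ge0 ?rnorm_ge0.
  have Nza : 0 < cnorm (z - a) by rewrite cnorm_gt0 subr_eq0.
  rewrite /G cnormM cnormV; have [zd|zd] := ltP (cnorm (z - a)) d; apply/orP.
    left; rewrite ler_pdivrMr//; have := H _ zd; rewrite [a + _]addrC subrK => H1.
    rewrite -[f z - f a](subrK (c * (z - a))) (le_trans (ler_rnormD _ _))//.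
    by rewrite cnormM mulrDl lerD.
  right; apply: ler_pM; rewrite ?rnorm_ge0 ?invr_ge0 ?rnorm_ge0//.
    by rewrite (le_trans (ler_rnormB _ _))// lerD ?fk.
  by rewrite lef_pV2.
(* The centre [a], where [G] may fail to be differentiable, is a corner of all four quarters. *)
have Gs : contour_small G (a - s%:C - 'i%C * s%:C) (s + s).
  have corner (c d : bool) o : o + (c%:R * s)%:C + 'i%C * (d%:R * s)%:C = a ->
      contour_small G o s.
    move=> oa; have Qo z : square o s z -> Q z.
      rewrite QE -oa /square; case: (z) => zx zy; case: (o) => x y; simpc => /=.
      by rewrite !ler_norml; case: c {oa}; case: d => /= -[H1 H2]; lra.
    apply: (@goursat_corner _ _ _ _ K c d s0); first by move=> z /Qo Qz; rewrite oa; exact: Gd.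
    by move=> z /Qo; exact: GK.
  apply: contour_small_split.
  - by apply: (corner true true); rewrite !mul1r; ring.
  - by apply: (corner false true); rewrite mul1r mul0r; ring.
  - by apply: (corner true false); rewrite mul1r mul0r; ring.
  - by apply: (corner false false); rewrite !mul0r; ring.
(* Write [f a / (z - a)] as [f z / (z - a) - G z]. Its contour sum is at least [4 * cnorm (f a)],
   the first term gives at most the perimeter [8 * s] times [m / s], and [G] contributes arbitrarily
   little. *)
suff : cnorm (f a) * 4 <= 8 * m by lra.
apply/ler_addgt0Pr => e /Gs[N /(_ _ (leqnn N))]; set o := a - _ - _ => Ge.
have M0 : (0 < 2 ^ N)%N by rewrite expn_gt0.
have lb := contour_inv_ge a M0 s0.
rewrite (le_trans (ler_wpM2l (rnorm_ge0 _) lb))// -cnormM -contourZ.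
have -> : (fun z => f a * (z - a)^-1) = fun z => f z / (z - a) + -1 * G z.
  by apply/funext => z; rewrite /G; ring.
rewrite contourD contourZ mulN1r (le_trans (ler_rnormB _ _))// lerD//.
have -> : 8 * m = 4 * (s + s) * (m / s) by field; rewrite gt_eqF.
apply: contour_bound => //; first lra.
move=> z [Qz bz].
have sz : s <= cnorm (z - a).
  move: bz; rewrite /o; have := ler_Re_cnorm (z - a); have := ler_Im_cnorm (z - a).
  case: (z) => zx zy; case: (a) => x y; simpc => /=; rewrite !ler_norml.
  by move=> H1 H2 [] E; lra.
rewrite cnormM cnormV; apply: ler_pM; rewrite ?rnorm_ge0 ?invr_ge0 ?rnorm_ge0//.
  exact: fm.
by rewrite lef_pV2// posrE (lt_le_trans s0).
Qed.

End cauchy_estimate.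

(** * The mean value inequality on a segment *)

Section mean_value.
Variable R : realType.
Implicit Types (f : R[i] -> R[i]) (p d : R[i]).

Lemma cmean_value f p d (L : R) :
  (forall t : R, 0 <= t <= 1 -> exists2 c, is_cderiv f (p + t%:C * d) c & cnorm c <= L) ->
  cnorm (f (p + d) - f p) <= L * cnorm d.
Proof.
move=> fL; have [->|d0] := eqVneq d 0.
  by rewrite addr0 subrr cnorm0 mulr0.
have Nd : 0 < cnorm d by rewrite cnorm_gt0.
rewrite leNgt; apply/negP; set D := cnorm (_ - _) => bad.
pose L' := (L + D / cnorm d) / 2.
have LD : L < D / cnorm d by rewrite ltr_pdivlMr.
have LL' : L < L' by rewrite /L'; lra.
have L'D : L' * cnorm d < D by rewrite -ltr_pdivlMr// /L'; lra.
pose ft t := f (p + t%:C * d).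
(* Excess slope [L'], strictly between [L] and the slope assumed for contradiction. The predicate
   reads only the real part of [q], so planar bisection acts on intervals. *)
pose A (q : R[i]) h :=
  L' * h * cnorm d < cnorm (ft (complex.Re q + h) - ft (complex.Re q)).
have A0 : A 0 1 by rewrite /A /ft /= add0r mulr1 mul0r mul1r addr0.
have Asplit q h : 0 < h -> A q (h + h) ->
    exists c d : bool, A (q + (c%:R * h)%:C + 'i%C * (d%:R * h)%:C) h.
  have qE (c : bool) : complex.Re (q + (c%:R * h)%:C + 'i%C * (false%:R * h)%:C) =
      complex.Re q + c%:R * h.
    by rewrite [false%:R * h]mul0r; case: (q) => x y; simpc.
  rewrite /A => h0 qb.
  have [big|small] := ltP (L' * h * cnorm d) (cnorm (ft (complex.Re q + h) - ft (complex.Re q))).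
    by exists false, false; rewrite qE mul0r addr0.
  exists true, false; rewrite qE mul1r; move: qb; rewrite addrA.
  have -> : ft (complex.Re q + h + h) - ft (complex.Re q) =
    ft (complex.Re q + h + h) - ft (complex.Re q + h) +
    (ft (complex.Re q + h) - ft (complex.Re q)) by ring.
  have := ler_rnormD (ft (complex.Re q + h + h) - ft (complex.Re q + h) : R[i]^o) (ft (complex.Re q + h) - ft (complex.Re q)).
  rewrite /=; lra.
have [z [t01 _] zP] := @square_bisection _ A 0 1 ltr01 A0 Asplit.
have [t tz] : exists t, t = complex.Re z by exists (complex.Re z).
rewrite add0r -tz in t01.
have [c fc cL] := fL _ t01.
have e0 : 0 < L' - L by rewrite subr_gt0.
have [e ep He] := fc _ e0.
have [q [h [h0 he [qz _] _ qb]]] := zP _ (divr_gt0 ep Nd).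
rewrite -tz in qz; rewrite ltr_pdivlMr// in he.
have inc u : complex.Re q <= u <= complex.Re q + h ->
    cnorm (ft u - ft t) <= L' * `|u - t| * cnorm d.
  move=> uq; have Nu : cnorm ((u - t)%:C * d) = `|u - t| * cnorm d by rewrite cnormM cnormR.
  have ut : `|u - t| <= h by rewrite ler_norml; lra.
  have := He ((u - t)%:C * d); rewrite Nu.
  have -> : p + t%:C * d + (u - t)%:C * d = p + u%:C * d by rewrite rmorphB/=; ring.
  move=> /(_ (le_lt_trans (ler_wpM2r (ltW Nd) ut) _)).
  move=> /(_ he) H.
  have := ler_rnormD (ft u - ft t - c * ((u - t)%:C * d) : R[i]^o) (c * ((u - t)%:C * d)).
  rewrite /= subrK cnormM Nu.
  have : cnorm c * (`|u - t| * cnorm d) <= L * (`|u - t| * cnorm d).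
    by rewrite ler_wpM2r// mulr_ge0 ?(ltW Nd).
  move: H; rewrite /ft; lra.
have i1 := inc (complex.Re q) ltac:(lra).
have i2 := inc (complex.Re q + h) ltac:(lra).
have := ler_rnormB (ft (complex.Re q + h) - ft t : R[i]^o) (ft (complex.Re q) - ft t).
have -> : ft (complex.Re q + h) - ft t - (ft (complex.Re q) - ft t) =
  ft (complex.Re q + h) - ft (complex.Re q) by ring.
rewrite ger0_norm in i2; last lra.
rewrite ler0_norm in i1; last lra.
by move: i1 i2 qb; rewrite /A; lra.
Qed.

End mean_value.

(** * The two-constants estimate and chains of balls *)

Section two_constants.
Variable R : realType.
Implicit Types (f : R[i] -> R[i]).

(* Apply [cauchy_estimate] to [f z / (z - 1 / 2) ^+ q]: where it is used, a   *)
(* point outside the unit disc is farther from 1 / 2 than 17 / 16 is, so that *)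
(* a large [q] beats the bound 1 there.                                        *)
Lemma two_constants_disc (e : R) : 0 < e -> exists2 eta : R, 0 < eta & forall f,
  (forall z, cnorm z <= 3 -> cdiff f z) -> (forall z, cnorm z <= 3 -> cnorm (f z) <= 1) ->
  (forall z, cnorm z <= 1 -> cnorm (f z) <= eta) ->
  cnorm (f (17 / 16 : R)%:C) <= e.
Proof.
move=> e0.
(* [r] is the distance from 17 / 16 to the pole 1 / 2. [k] is a lower bound for the distance to 1 /
   2 of points outside the unit disc and at least 1 / 2 away from 17 / 16. *)
have [r rE] : exists r : R, r = 9 / 16 by exists (9 / 16).
have [k kE] : exists k : R, k = 3 / 5 by exists (3 / 5).
have r0 : 0 < r by lra.
have k0 : 0 < k by lra.
have rk : r / k < 1 by rewrite ltr_pdivrMr//; lra.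
have [q qe] : exists q, 2 * (r / k) ^+ q <= e.
  have c1 : `|r / k| < 1 by rewrite ger0_norm// divr_ge0// ltW.
  have /cvgrPdist_le/(_ _ (divr_gt0 e0 (ltr0n R 2))) := cvg_expr c1.
  move=> [N _ /(_ N (leqnn N))]; rewrite /= sub0r normrN => H; exists N.
  by have := le_trans (ler_norm _) H; lra.
(* The square about 17 / 16 stays at distance at least 1 / 16 from the pole, so the division costs
   at most [16 ^+ q]. *)
exists (e / 2 / 16 ^+ q); first by rewrite !divr_gt0// exprn_gt0.
move=> f fd f1 fs.
pose b : R[i] := (1 / 2 : R)%:C; pose a : R[i] := (17 / 16 : R)%:C.
pose F z := f z / (z - b) ^+ q.
have s0 : 0 < 1 / 2 :> R by rewrite divr_gt0.
set Q := square (a - (1 / 2 : R)%:C - 'i%C * (1 / 2 : R)%:C) (1 / 2 + 1 / 2).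
have Qb z : Q z -> 1 / 16 <= cnorm (z - b) /\ cnorm z <= 3.
  have := ler_Re_cnorm (z - b); have := ler_cnorm_ReIm z.
  rewrite /Q /square /a /b; case: (z) => x y; simpc => /=.
  rewrite !ler_norml => H1 H2 [H3 H4]; split; first lra.
  rewrite (le_trans H1)// [X in X + _]ger0_norm; last lra.
  have : `|y| <= 1 / 2 by rewrite ler_norml; lra.
  lra.
have zb z : Q z -> z != b.
  by move=> /Qb[H _]; rewrite -subr_eq0 -cnorm_gt0; lra.
have Fd z : Q z -> cdiff F z.
  move=> Qz; rewrite /F; elim: (q) => [|n IH].
    have -> : (fun z => f z / (z - b) ^+ 0) = f by apply/funext => w; rewrite expr0 divr1.
    by apply: fd; case: (Qb _ Qz).
  have -> : (fun z => f z / (z - b) ^+ n.+1) = fun z => f z / (z - b) ^+ n / (z - b).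
    by apply/funext => w; rewrite exprS invfM mulrA mulrAC.
  by apply: cdiff_divB => //; exact: zb.
have NF z : cnorm (F z) = cnorm (f z) / cnorm (z - b) ^+ q.
  by rewrite cnormM cnormV cnormX.
have Fb z m : Q z -> cnorm (f z) <= m -> cnorm (F z) <= m * 16 ^+ q.
  move=> /Qb[H _] fm; have Nz : 0 < cnorm (z - b) by lra.
  rewrite NF ler_pdivrMr ?exprn_gt0// (le_trans fm)//.
  rewrite -mulrA -exprMn ler_peMr ?(le_trans (rnorm_ge0 _) fm)//.
  by apply: exprn_ege1; lra.
have rq : 0 < r ^+ q by rewrite exprn_gt0.
have kq : 0 < k ^+ q by rewrite exprn_gt0.
have Nfa : cnorm (f a) = cnorm (F a) * r ^+ q.
  have Nab : cnorm (a - b) = r by rewrite /a /b -rmorphB cnormR rE ger0_norm; lra.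
  by rewrite NF Nab divfK// gt_eqF.
suff : cnorm (F a) <= 2 * (e / 2 / r ^+ q).
  rewrite mulrA (_ : 2 * (e / 2) = e); last by field.
  by rewrite ler_pdivlMr// -Nfa.
apply: (@cauchy_estimate _ F a (1 / 2)) => //.
move=> z Qz za; have [z1|z1] := leP (cnorm z) 1.
  apply: le_trans (Fb _ _ Qz (fs _ z1)) _.
  have e2 : 0 <= e / 2 by lra.
  rewrite divfK ?expf_neq0// ler_peMr// invf_ge1// exprn_ile1//; lra.
have zbk : k <= cnorm (z - b).
  rewrite -(@ler_pXn2r _ 2) ?nnegrE ?rnorm_ge0 ?(ltW k0)//.
  have : 1 ^+ 2 <= cnorm z ^+ 2 by rewrite ler_pXn2r ?nnegrE ?rnorm_ge0 ?ler01 ?(ltW z1).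
  have : (1 / 2) ^+ 2 <= cnorm (z - a) ^+ 2 by rewrite ler_pXn2r ?nnegrE ?rnorm_ge0 ?(ltW s0).
  rewrite kE !cnorm_sqr /a /b; case: (z) => x y; simpc => /=.
  lra.
have Nz : 0 < cnorm (z - b) by lra.
rewrite NF ler_pdivrMr ?exprn_gt0//.
apply: le_trans (f1 _ _) _; first by case: (Qb _ Qz).
rewrite mulrAC ler_pdivlMr// mul1r.
have -> : r ^+ q = (r / k) ^+ q * k ^+ q by rewrite -exprMn divfK// gt_eqF.
apply: ler_pM; rewrite ?exprn_ge0 ?divr_ge0 ?(ltW k0) ?(ltW r0)//; first lra.
by rewrite lerXn2r ?nnegrE ?rnorm_ge0 ?(ltW k0).
Qed.

End two_constants.

Section propagation.
Variables (R : realType) (X : normedModType R[i]).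
Implicit Types (g : X -> R[i]^o) (p v w x z : X).

Lemma is_cderiv_line g p v (l : R[i]) : differentiable g (p + l *: v) ->
  is_cderiv (fun a => g (p + a *: v)) l ('d g (p + l *: v) v).
Proof.
move=> gd e e0.
have v1 : 0 < 1 + rnorm v by rewrite ltr_pwDl// rnorm_ge0.
have [d d0 H] := differentiable_rnorm gd (divr_gt0 e0 v1).
exists (d / (1 + rnorm v)); first by rewrite divr_gt0.
move=> h; rewrite ltr_pdivlMr// => hd.
have Nh : rnorm (h *: v) <= cnorm h * (1 + rnorm v).
  by rewrite rnormZ ler_wpM2l ?rnorm_ge0// lerDr.
have := H (h *: v) (le_lt_trans Nh hd).
have -> : h *: v + (p + l *: v) = p + (l + h) *: v by rewrite scalerDl addrC addrA.
rewrite linearZ/= [h *: ('d _ _ _ : R[i]^o)]mulrC => /le_trans; apply.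
by rewrite mulrAC ler_pdivrMr// -mulrA ler_wpM2l// ltW.
Qed.

(** Restrict to the complex line through [p] and [x], scaled so that the unit disc lands in the ball
    of radius [rho] and 17 / 16 goes to [x]. *)
Lemma two_constants_ball (e : R) : 0 < e -> exists2 eta : R, 0 < eta &
  forall g p (rho : R), 0 < rho ->
  (forall x, rnorm (x - p) <= 3 * rho -> differentiable g x /\ rnorm (g x) <= 1) ->
  (forall x, rnorm (x - p) <= rho -> rnorm (g x) <= eta) ->
  forall x, rnorm (x - p) <= 17 / 16 * rho -> rnorm (g x) <= e.
Proof.
move=> /two_constants_disc[eta eta0 H]; exists eta => // g p rho rho0 gd gs x xp.
pose v := (16 / 17 : R)%:C *: (x - p).
have v1 : rnorm v <= rho by rewrite rnormZr//; lra.
have lv (l : R[i]) (t : R) : cnorm l <= t -> rnorm (p + l *: v - p) <= t * rho.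
  by move=> lt; rewrite addrAC subrr add0r rnormZ ler_pM ?rnorm_ge0.
have -> : x = p + (17 / 16 : R)%:C *: v.
  rewrite scalerA -rmorphM/= (_ : _ * _ = 1 :> R); last by field.
  by rewrite scale1r addrC subrK.
apply: (H (fun l => g (p + l *: v))).
- move=> l l3; exists ('d g (p + l *: v) v); apply: is_cderiv_line.
  by case: (gd _ (lv _ _ l3)).
- by move=> l l3; case: (gd _ (lv _ _ l3)).
- by move=> l l1; apply: gs; rewrite -[rho]mul1r; exact: lv.
Qed.

(** As a step is at most [rho / 16], the enlarged ball at one centre contains the ball of radius
    [rho] at the next. Thresholds are chosen backwards from [e]. *)
Lemma propagate_chain (n : nat) (e : R) : 0 < e -> exists2 eta : R, 0 < eta &
  forall g p w (rho : R), 0 < rho -> rnorm w <= rho / 16 ->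
  (forall j x, (j <= n)%N -> rnorm (x - (p + w *+ j)) <= 3 * rho ->
     differentiable g x /\ rnorm (g x) <= 1) ->
  (forall x, rnorm (x - p) <= rho -> rnorm (g x) <= eta) ->
  forall x, rnorm (x - (p + w *+ n)) <= rho -> rnorm (g x) <= e.
Proof.
elim: n e => [|n IH] e e0.
  exists e => // g p w rho _ _ _ gs x; rewrite mulr0n addr0; exact: gs.
have [e1 e10 H1] := two_constants_ball e0.
have [eta eta0 H] := IH _ e10; exists eta => // g p w rho rho0 wr gd gs x xp.
apply: (H1 g (p + w *+ n) rho) => //.
- by move=> y; apply: gd.
- by apply: (H g p w rho) => // j y jn; apply: gd; exact: leqW.
- have -> : x - (p + w *+ n) = x - (p + w *+ n.+1) + w.
    by rewrite mulrSr [p + (_ + w)]addrA [- (_ + w)]opprD [x + (_ - w)]addrA subrK.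
  by rewrite (le_trans (ler_rnormD _ _))//; lra.
Qed.

(** Join [z0] to [z] by a straight chain. Their distance is at most 2, so the number of steps, and
    with it [eta], is independent of [g] and [z]. *)
Lemma small_propagates z0 (rho r e : R) : unit_ball X z0 -> 0 < rho -> r < 1 -> 0 < e ->
  exists2 eta : R, 0 < eta & forall g, holomorphic g ->
  (forall x, unit_ball X x -> rnorm (g x) <= 1) ->
  (forall x, rnorm (x - z0) <= rho -> rnorm (g x) <= eta) ->
  forall z, rnorm z <= r -> rnorm (g z) <= e.
Proof.
move=> z01 rho0 r1 e0.
pose r2 := Num.max r (rnorm z0).
have r21 : r2 < 1 by rewrite gt_max r1.
(* A quarter of the gap to the sphere keeps the balls of radius [3 * rh] along the chain inside the
   unit ball. *)
pose rh := Num.min rho ((1 - r2) / 4).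
have rh0 : 0 < rh by rewrite lt_min rho0 divr_gt0//; lra.
have [n nP] : exists n : nat, 2 <= n.+1%:R * (rh / 16).
  have := archi_boundP (_ : 0 <= 2 / (rh / 16)); set n := Num.bound _ => /(_ _) H.
  exists n; rewrite -ler_pdivrMr ?divr_gt0// ltW// (lt_trans (H _))//.
    by rewrite ltW// !divr_gt0.
  by rewrite ltr_nat.
have [eta eta0 H] := propagate_chain n.+1 e0; exists eta => // g gh g1 gs z zr.
have rh4 : rh <= (1 - r2) / 4 by rewrite ge_min lexx orbT.
pose w := (n.+1%:R^-1 : R)%:C *: (z - z0).
have n0 : 0 < n.+1%:R :> R by [].
have z2 : rnorm z <= r2 by rewrite le_max zr.
have z02 : rnorm z0 <= r2 by rewrite le_max lexx orbT.
have pj j : z0 + w *+ j = ((1 - j%:R / n.+1%:R : R)%:C *: z0 + (j%:R / n.+1%:R : R)%:C *: z).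
  rewrite /w -scaler_nat scalerA -(rmorph_nat (real_complex R)) -rmorphM/= rmorphB/= scalerBl.
  by rewrite scalerBr scale1r addrA addrAC.
have pr j : (j <= n.+1)%N -> rnorm (z0 + w *+ j) <= r2.
  move=> jn; rewrite pj (le_trans (ler_rnormD _ _))//.
  have j1 : j%:R / n.+1%:R <= 1 :> R by rewrite ler_pdivrMr// mul1r ler_nat.
  have j0 : 0 <= j%:R / n.+1%:R :> R by rewrite divr_ge0.
  move: (j%:R / _) j0 j1 => t t0 t1.
  rewrite !rnormZr//; last lra.
  have := ler_wpM2l t0 z2; have : (1 - t) * rnorm z0 <= (1 - t) * r2 by rewrite ler_wpM2l//; lra.
  lra.
apply: (H g z0 w rh) => //.
- rewrite rnormZr ?invr_ge0//.
  have := ler_rnormB z z0; rewrite mulrC ler_pdivrMr//; lra.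
- move=> j x jn xj; have bx : unit_ball X x.
    rewrite /unit_ball/= -[x](subrK (z0 + w *+ j)) (le_lt_trans (ler_rnormD _ _))//.
    by have := pr j jn; lra.
  by split; [exact: gh | exact: g1].
- by move=> x xr; apply: gs; rewrite (le_trans xr)// ge_min lexx.
- rewrite pj divff ?gt_eqF// subrr scale0r add0r scale1r subrr rnorm0.
  exact: ltW.
Qed.

End propagation.

(** * Bloch spaces *)

Section bloch_pointwise.
Variables (R : realType) (X : normedModType R[i]).

Lemma weight_lower_bound (mu : normal_weight R) (r : R) : r < 1 ->
  exists2 m : R, 0 < m & forall t, 0 <= t <= r -> m <= mu t.
Proof.
move=> r1; have [r0|r0] := ltP r 0.
  by exists 1 => // t /andP[t0 /(le_trans t0)]; rewrite leNgt r0.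
have cmu : {within `[0, r], continuous mu}.
  case: (weightP mu) => cmu _ _; apply: continuous_subspaceW cmu => t /=.
  by rewrite !in_itv/= => /andP[-> /le_lt_trans->].
have [c cr cmin] := EVT_min r0 cmu.
exists (mu c); last by move=> t tr; apply: cmin; rewrite in_itv.
by apply: weight_gt0; move: cr; rewrite in_itv/= => /andP[-> /le_lt_trans->].
Qed.

Lemma convex_itv (a v w t : R) : - a <= v <= a -> - a <= w <= a -> 0 <= t <= 1 ->
  - a <= v + t * (w - v) <= a.
Proof.
move=> /andP[v1 v2] /andP[w1 w2] /andP[t0 t1]; have t1' : 0 <= 1 - t by lra.
have -> : v + t * (w - v) = (1 - t) * v + t * w by ring.
have := ler_wpM2l t1' v1; have := ler_wpM2l t1' v2.
have := ler_wpM2l t0 w1; have := ler_wpM2l t0 w2; lra.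
Qed.

Lemma nearest_unit (u : R) : - 1 <= u <= 1 -> exists s : R,
  [/\ s = 1 \/ s = - 1, - 1 <= u - s <= 1 &
  forall t : R, 0 <= t <= 1 -> u ^+ 2 <= (s + t * (u - s)) ^+ 2].
Proof.
move=> uh; have [u0|u0] := leP 0 u; [exists 1|exists (- 1)];
  (split; [by [left|right]|lra|]) => t /andP[t0 t1].
  have : 0 <= (1 - t) * (1 - u) by rewrite mulr_ge0; lra.
  by move=> h; rewrite ler_pXn2r ?nnegrE//; lra.
have : 0 <= (1 - t) * (1 + u) by rewrite mulr_ge0; lra.
by move=> h; rewrite -[u ^+ 2]sqrrN -[X in _ <= X]sqrrN ler_pXn2r ?nnegrE//; lra.
Qed.

(* From 1, walk vertically to a corner, along the horizontal edge to the      *)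
(* corner nearest to [l], and straight to [l]: this avoids the unit disc.     *)
Lemma ring_oscillation (g : R[i] -> R[i]) (L : R) :
  (forall p d, (forall t : R, 0 <= t <= 1 -> 1 <= cnorm (p + t%:C * d) <= 2) ->
     cnorm d <= 2 -> cnorm (g (p + d) - g p) <= L) ->
  forall l, - 1 <= complex.Re l <= 1 -> - 1 <= complex.Im l <= 1 -> 1 <= cnorm l ->
  cnorm (g l - g 1) <= 3 * L.
Proof.
move=> seg [x y] /= xh yh Nxy.
have norm_le2 (u v : R) : - 1 <= u <= 1 -> - 1 <= v <= 1 -> cnorm (u +i* v) <= 2.
  move=> uh vh; rewrite (le_trans (ler_cnorm_ReIm _))//= -[2]/(1 + 1) lerD//.
    by rewrite ler_norml.
  by rewrite ler_norml.
have path (v w v' w' : R) : - 1 <= v <= 1 -> - 1 <= w <= 1 ->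
    - 1 <= v' <= 1 -> - 1 <= w' <= 1 ->
    (forall t : R, 0 <= t <= 1 ->
      1 <= (v + t * (v' - v)) ^+ 2 + (w + t * (w' - w)) ^+ 2) ->
    cnorm ((v' - v) +i* (w' - w)) <= 2 ->
    cnorm (g (v' +i* w') - g (v +i* w)) <= L.
  move=> vh wh vh' wh' far1 d1.
  have -> : v' +i* w' = (v +i* w) + ((v' - v) +i* (w' - w)).
    by simpc; rewrite ![_ + (_ - _)]addrC !subrK.
  apply: seg => // t t01; rewrite [t%:C * _](_ : _ = (t * (v' - v)) +i* (t * (w' - w))).
    rewrite [_ + _](_ : _ = (v + t * (v' - v)) +i* (w + t * (w' - w)))//.
    rewrite norm_le2 ?convex_itv// andbT -(@ler_pXn2r _ 2) ?nnegrE ?rnorm_ge0//.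
    by rewrite cnorm_sqr/= expr1n far1.
  by simpc.
have one : - 1 <= (1 : R) <= 1 by rewrite lexx; lra.
have unit_itv (s : R) : s = 1 \/ s = - 1 -> - 1 <= s <= 1 by case=> ->; lra.
have unit_sqr (s : R) : s = 1 \/ s = - 1 -> s ^+ 2 = 1.
  by case=> ->; rewrite ?sqrrN expr1n.
have [s [/[dup] /unit_itv s1 /unit_sqr ss xs sx]] := nearest_unit xh.
have [u [/[dup] /unit_itv u1 /unit_sqr uu yu uy]] := nearest_unit yh.
have p1 : cnorm (g (1 +i* u) - g (1 +i* 0)) <= L.
  apply: path => //; first lra.
    by move=> t _; rewrite subrr mulr0 addr0 expr1n lerDl sqr_ge0.
  by apply: norm_le2; rewrite ?subrr ?subr0//; lra.
have p2 : cnorm (g (s +i* u) - g (1 +i* u)) <= L.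
  apply: path => //.
    by move=> t _; rewrite subrr mulr0 addr0 uu lerDr sqr_ge0.
  rewrite subrr (le_trans (ler_cnorm_ReIm _))//= normr0 addr0 ler_norml; lra.
have p3 : cnorm (g (x +i* y) - g (s +i* u)) <= L.
  apply: path => //; last exact: norm_le2.
  move=> t t01; apply: le_trans (lerD (sx t t01) (uy t t01)).
  rewrite -[1](expr1n _ 2).
  have := cnorm_sqr (x +i* y) => /= <-.
  by rewrite ler_pXn2r ?nnegrE ?rnorm_ge0.
have -> : g (x +i* y) - g 1 = (g (x +i* y) - g (s +i* u)) +
   ((g (s +i* u) - g (1 +i* u)) + (g (1 +i* u) - g (1 +i* 0))) by rewrite -[g 1]/(g (1 +i* 0)); ring.
rewrite (le_trans (ler_rnormD _ _))//.
have := ler_rnormD (g (s +i* u) - g (1 +i* u) : R[i]^o) (g (1 +i* u) - g (1 +i* 0)).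
move: p1 p2 p3; rewrite /=; lra.
Qed.

(** With [g l] the value of [f] at [l *: w] and [w] half of [z], the Bloch seminorm bounds [l] times
    the derivative of [g], hence the derivative by [L] for [l] of modulus between 1 and 2. This does
    not reach [g 0] by mean values; instead the oscillation bound [3 * (2 * L)] around the unit disc
    and [cauchy_estimate] give [12 * L] for [g 0 - g 1]. The segment from 1 to 2 adds [L], and 14
    rounds up the total. *)
Lemma bloch_growth (mu : normal_weight R) (r : R) : r < 1 ->
  exists2 C : R, 0 < C & forall (f : bloch X mu) z, rnorm z <= r ->
  rnorm (f z) <= C * rnorm f.
Proof.
move=> r1; have [m m0 mP] := weight_lower_bound mu r1.
exists (1 + 14 / m); first by rewrite addr_gt0// divr_gt0.
move=> f z zr.
set tau := sup (bloch_values mu f).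
have tau0 : 0 <= tau by exact: bloch_sup_ge0.
have Nf : rnorm f = rnorm (f 0) + tau by [].
have [w wE] : exists w, w = (2^-1 : R)%:C *: z by exists ((2^-1 : R)%:C *: z).
have wr : 2 * rnorm w <= r by rewrite wE rnormZr// mulrA divff// mul1r.
pose g (l : R[i]) : R[i] := f (0 + l *: w).
have Nlw (l : R[i]) : cnorm l <= 2 -> rnorm (0 + l *: w) <= r.
  by move=> l1; rewrite add0r rnormZ (le_trans _ wr)// ler_wpM2r// rnorm_ge0.
have Blw (l : R[i]) : cnorm l <= 2 -> unit_ball X (0 + l *: w).
  by move=> /Nlw lw; rewrite /unit_ball/= (le_lt_trans lw).
have gd (l : R[i]) : cnorm l <= 2 -> is_cderiv g l ('d f (0 + l *: w) w).
  by move=> l1; apply: is_cderiv_line; apply: bloch_holomorphic; exact: Blw.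
pose L := tau / m.
have L0 : 0 <= L by rewrite /L divr_ge0 ?(ltW m0).
have gL (l : R[i]) : 1 <= cnorm l <= 2 -> cnorm ('d f (0 + l *: w) w) <= L.
  move=> /andP[l1 l2].
  have := bloch_sup_ub (f := f) (ex_intro2 _ _ _ (Blw _ l2) erefl).
  have dE : 'd f (0 + l *: w) (0 + l *: w) = l *: 'd f (0 + l *: w) w.
    by rewrite -linearZ; exact: (congr1 ('d f (0 + l *: w)) (add0r _)).
  rewrite -/tau /radial_derivative dE rnormZ => H.
  have mm : m <= mu (rnorm (0 + l *: w)) by apply: mP; rewrite rnorm_ge0 Nlw.
  have D0 := rnorm_ge0 ('d f (0 + l *: w) w).
  rewrite /L ler_pdivlMr// mulrC (le_trans _ H)// ler_pM ?(ltW m0)//.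
  by rewrite ler_peMl.
have seg (p d : R[i]) : (forall t : R, 0 <= t <= 1 -> 1 <= cnorm (p + t%:C * d) <= 2) ->
    cnorm (g (p + d) - g p) <= L * cnorm d.
  move=> pd; apply: cmean_value => t /pd td.
  by exists ('d f (0 + (p + t%:C * d) *: w) w); [apply: gd; case/andP: td|exact: gL].
have near0 : cnorm (g 0 - g 1) <= 2 * (3 * (2 * L)).
  apply: (@cauchy_estimate _ (fun l => g l - g 1) 0 1) => //.
    move=> l lQ; apply: cdiffBc; eexists; apply: gd.
    rewrite (le_trans (ler_cnorm_ReIm _))//; move: lQ; rewrite /square.
    case: l => x y; simpc => /= -[xh yh].
    have : `|x| <= 1 by rewrite ler_norml; lra.
    have : `|y| <= 1 by rewrite ler_norml; lra.
    lra.
  move=> l [lx ly]; rewrite subr0 => l1; apply: ring_oscillation => //.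
  - move=> p d /seg pd d2; rewrite (le_trans pd)// mulrC ler_wpM2r//.
  - by move: lx; simpc => /=; lra.
  - by move: ly; simpc => /=; lra.
have far : cnorm (g 2 - g 1) <= L.
  have -> : 2 = 1 + 1 :> R[i] by [].
  rewrite (le_trans (seg _ _ _)) ?cnorm1 ?mulr1// => t t01.
  by rewrite mulr1 -[1 : R[i]]/((1 : R)%:C) -rmorphD/= cnormR ger0_norm; lra.
have -> : f z = (g 2 - g 1) - (g 0 - g 1) + f 0 :> R[i].
  have <- : 2%:R *: w = z.
    rewrite wE scalerA -(rmorph_nat (real_complex R)) -rmorphM/= divff//.
    by rewrite scale1r.
  by rewrite /g !add0r scale0r; ring.
rewrite (le_trans (ler_rnormD _ _))// Nf.
have := ler_rnormB (g 2 - g 1 : R[i]^o) (g 0 - g 1).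
have : L * 14 = 14 / m * tau by rewrite /L; field; rewrite gt_eqF.
have : 0 <= 14 / m * rnorm (f 0) by rewrite mulr_ge0 ?rnorm_ge0// divr_ge0// ltW.
move: near0 far L0; rewrite /=; lra.
Qed.

End bloch_pointwise.

(** * Hilbert spaces and precompactness *)

Section hilbert.
Variables (R : realType) (X : normedModType R[i]).
Variable dot : {dot X for (@Num.conj R[i])}.
Hypothesis dotE : forall x : X, `|x| ^+ 2 = dot x x.
Implicit Types x y z : X.

Lemma dot_conj x y : dot y x = (dot x y)^*.
Proof. by rewrite hermC expr0 mul1r. Qed.

Lemma dot_cauchy_schwarz x y : rnorm (dot x y : R[i]^o) <= rnorm x * rnorm y.
Proof.
have [->|y0] := eqVneq y 0; first by rewrite linear0r !rnorm0 mulr0.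
set a := dot x y; set b := dot y y.
have b0 : 0 < b by rewrite neq0_dnorm_gt0.
have bJ : b^* = b by rewrite -dot_conj.
have : 0 <= b * (b * dot x x - a * a^*).
  have <- : `|b *: x - a *: y| ^+ 2 = b * (b * dot x x - a * a^*).
    rewrite dotE linearBl linearBr !linearZl_LR/= linearBr !linearZr_LR/= bJ.
    rewrite (dot_conj x y) -/a -/b.
    transitivity (b * (b * dot x x) - a^* * (b * a) - a * (b * a^* - a^* * b)) => //.
    by ring.
  by rewrite exprn_ge0.
rewrite pmulr_rge0// subr_ge0 -normCK -dotE /b -dotE => H.
rewrite -(@ler_pXn2r _ 2) ?nnegrE ?mulr_ge0 ?rnorm_ge0//.
by rewrite -lecR !rmorphXn/= rmorphM/= !rnormE exprMn mulrC.
Qed.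

Lemma le_rnorm_dot x (e : R) : 0 <= e ->
  (forall y, rnorm y <= 1 -> rnorm (dot x y : R[i]^o) <= e) -> rnorm x <= e.
Proof.
move=> e0 H; have [->|x0] := eqVneq x 0; first by rewrite rnorm0.
have Nx : 0 < rnorm x by rewrite lt_neqAle rnorm_ge0 eq_sym rnorm_eq0 x0.
have := H ((rnorm x)^-1%:C *: x); rewrite rnormZr ?invr_ge0 ?(ltW Nx)// mulVf ?gt_eqF//.
move=> /(_ (lexx _)); congr (_ <= _).
rewrite linearZr_LR/= cnormM -dotE -rnormE -rmorphXn/= [X in cnorm X](_ : _ = (rnorm x)^-1%:C).
  rewrite !cnormR !ger0_norm ?exprn_ge0 ?invr_ge0 ?(ltW Nx)// expr2 mulrA mulVf ?mul1r//.
  by rewrite gt_eqF.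
by rewrite conj_Creal// complex_real.
Qed.

Definition dotl y : X -> R[i]^o := fun x => dot x y.

Lemma dotl_linear y : linear (dotl y).
Proof. by move=> a u v; rewrite /dotl linearDl linearZl_LR. Qed.

HB.instance Definition _ y := GRing.isLinear.Build _ _ _ _ (dotl y) (dotl_linear y).

Lemma dotl_continuous y : continuous (dotl y).
Proof.
apply: bounded_linear_continuous; apply/linear_boundedP.
near=> r => x.
have yr : `|y| <= r by near: r; apply: nbhs_pinfty_ge; exact: normr_real.
apply: (le_trans _ (ler_wpM2r (normr_ge0 x) yr)).
by rewrite -!rnormE -rmorphM/= lecR mulrC; exact: dot_cauchy_schwarz.
Unshelve. all: by end_near. Qed.

End hilbert.

(** * Ultrafilters, finite nets and total boundedness *)

Lemma ultra_bounded_near (R : realType) (T : Type) (F : set_system T)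
    (u : T -> R) (M e : R) :
  UltraFilter F -> F [set x | `|u x| <= M] -> 0 < e ->
  exists l, F [set x | `|u x - l| < e].
Proof.
move=> FU FM e0.
have FMu : (u @ F) `[- M, M]%classic.
  by apply: (@filterS _ F _ _ _ _ FM) => x /=; rewrite in_itv/= ler_norml.
have [l [_ lP]] := @segment_compact R (- M) M (u @ F) _ FMu.
exists l; have [//|FC] := in_ultra_setVsetC [set x | `|u x - l| < e] FU.
have FuC : (u @ F) [set v | ~ (`|v - l| < e)] by [].
have lb : nbhs l (ball l e) by exact: nbhsx_ballx.
have [v [/= vC vl]] := lP _ _ FuC lb.
by case: vC; rewrite distrC; move: vl; rewrite -ball_normE.
Qed.

Lemma filter_forall_seq (T : Type) (I : eqType) (F : set_system T)
    {FF : Filter F} (P : I -> set T) (s : seq I) :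
  (forall i, i \in s -> F (P i)) ->
  F [set x | forall i, i \in s -> P i x].
Proof.
elim: s => [|i s IH] H; first by apply: filterS filterT => x _ i.
have Fi : F (P i) by apply: H; rewrite mem_head.
have Fs := IH (fun j js => H j (mem_behead (s := i :: s) js)).
by apply: filterS2 Fi Fs => x Pi Ps j; rewrite inE => /predU1P[->|/Ps].
Qed.

Lemma norm_ballP (R : realType) (V : normedModType R[i]) (x y : V) (e : R) :
  ball x e%:C y <-> rnorm (x - y) < e.
Proof. by rewrite -ball_normE/= -rnormE ltcR. Qed.

Lemma closure_approx (R : realType) (V : normedModType R[i]) (A : set V) x (e : R) :
  closure A x -> 0 < e -> exists2 a, A a & rnorm (x - a) < e.
Proof.
move=> Ax e0; have /Ax[a [Aa xa]] : nbhs x (ball x e%:C).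
  by apply: nbhsx_ballx; rewrite ltcR.
by exists a => //; apply/norm_ballP.
Qed.

(** Balls about the points [f i] already cover the closure, so the net can be indexed by members of
    [D]. *)
Lemma precompact_finite_net (R : realType) (V : normedModType R[i]) (I : choiceType)
    (D : set I) (f : I -> V) (e : R) : precompact (f @` D) -> 0 < e ->
  exists2 s : seq I, (forall i, i \in s -> D i) &
    forall i, D i -> exists2 j, j \in s & rnorm (f i - f j) < e.
Proof.
rewrite precompactE compact_cover => cD e0.
have [|x Dx|s sD cs] := cD I D (fun i => ball (f i) e%:C).
- by move=> i _; exact: ball_open.
- have [_ [i Di <-] xi] := closure_approx Dx e0.
  by exists i => //; apply/norm_ballP; rewrite rnormB_sym.
exists (finmap.enum_fset s) => [i si|i Di]; first by have := sD i si; rewrite inE.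
have [|j js /norm_ballP ij] := cs (f i); first by apply: subset_closure; exists i.
by exists j => //; rewrite rnormB_sym.
Qed.

Section dot_precompact.
Variables (R : realType) (X : completeNormedModType R[i]).
Variable dot : {dot X for (@Num.conj R[i])}.
Hypothesis dotE : forall x : X, `|x| ^+ 2 = dot x x.

(* The coordinates [dot x y], [y] in the finite net, converge along any       *)
(* ultrafilter and control distances in [A] up to [e].                         *)
Lemma precompact_dot (A : set X) : (forall x, A x -> rnorm x <= 1) ->
  (forall e : R, 0 < e -> exists2 s : seq X, (forall y, y \in s -> rnorm y <= 1) &
     forall y, rnorm y <= 1 -> exists2 y', y' \in s &
       forall x, A x -> rnorm (dot x (y - y') : R[i]^o) <= e) ->
  precompact A.
Proof.
move=> A1 Anet; rewrite precompactE compact_ultra => F FU FA.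
have FF : ProperFilter F by exact: ultra_proper.
suff /cauchy_cvg/cvg_ex[l Fl] : cauchy F.
  exists l; split=> //; apply: closed_closure => B Bl.
  exact: (filter_ex (filterI FA (Fl B Bl))).
apply: cauchy_exP => e' e'0.
have [e e0 ->] : exists2 e : R, 0 < e & e' = e%:C.
  exists (complex.Re e'); last by rewrite RRe_real// gtr0_real.
  by rewrite -ltcR RRe_real// gtr0_real.
have d0 : 0 < e / 10 by rewrite divr_gt0.
(* The budget is [8 * d] between two points of [A] and less than [d] for each passage from the
   closure to [A]. *)
pose d := e / 10; rewrite -/d in d0.
have [s s1 sA] := Anet _ d0.
have clA1 x : closure A x -> rnorm x <= 1.
  move=> Ax; apply/ler_addgt0Pr => h h0.
  have [a Aa xa] := closure_approx Ax h0.
  by rewrite -[x](subrK a) (le_trans (ler_rnormD _ _))// addrC lerD ?A1 ?ltW.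
have /boolp.choice[l lP] : forall y, exists l : R[i], y \in s ->
    F [set x | cnorm (dot x y - l) < 2 * d].
  move=> y; have [ys|ys] := boolP (y \in s); last by exists 0.
  have dot1 x : closure A x -> cnorm (dot x y) <= 1.
    move=> Ax; rewrite (le_trans (dot_cauchy_schwarz dotE x y))//.
    by rewrite mulr_ile1 ?rnorm_ge0//; [exact: clA1|exact: s1].
  have [|u Fu] := @ultra_bounded_near _ _ F (fun x => complex.Re (dot x y)) 1 d FU _ d0.
    by apply: filterS FA => x /dot1; exact/le_trans/ler_Re_cnorm.
  have [|v Fv] := @ultra_bounded_near _ _ F (fun x => complex.Im (dot x y)) 1 d FU _ d0.
    by apply: filterS FA => x /dot1; exact/le_trans/ler_Im_cnorm.
  exists (u +i* v) => _; apply: filterS2 Fu Fv => x /= xu xv.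
  rewrite (le_lt_trans (ler_cnorm_ReIm _))//; move: xu xv.
  by case: (dot x y) => p q; simpc => /=; lra.
have FEA : F (closure A `&` [set x | forall y, y \in s -> cnorm (dot x y - l y) < 2 * d]).
  by apply: filterI => //; exact: filter_forall_seq lP.
have [z [Az zE]] := filter_ex FEA.
exists z; apply: filterS FEA => x [Ax xE]; apply/norm_ballP.
have [a Aa za] := closure_approx Az d0.
have [b Ab xb] := closure_approx Ax d0.
have ab : rnorm (a - b) <= 8 * d.
  apply: (le_rnorm_dot dotE); first by rewrite mulr_ge0// ltW.
  move=> y /sA[y' y's yy'].
  (* Replacing [y] by [y'] costs [2 * d], comparing the coordinates of [z] and [x] with [l y'] costs
     [4 * d], and exchanging [a], [b] for [z], [x] costs [2 * d]. *)
  have -> : dot (a - b) y = (dot a (y - y') - dot b (y - y')) +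
     ((dot z y' - l y') - (dot x y' - l y') - (dot (z - a) y' - dot (x - b) y')).
    by rewrite !linearBl !linearBr; ring.
  have sm w c : rnorm (w - c) < d -> cnorm (dot (w - c) y') <= d.
    move=> wc; rewrite (le_trans (dot_cauchy_schwarz dotE _ _))//.
    by rewrite (le_trans (ler_piMr (rnorm_ge0 _) (s1 _ y's)))// ltW.
  have D1 := yy' a Aa; have D2 := yy' b Ab; have D3 := sm _ _ za; have D4 := sm _ _ xb.
  have /= D5 := zE y' y's; have /= D6 := xE y' y's.
  move: D1 D2 D3 D4 D5 D6.
  set c1 := dot a _; set c2 := dot b _; set c3 := dot (z - a) _; set c4 := dot (x - b) _.
  set c5 := dot z y' - _; set c6 := dot x y' - _.
  have := ler_rnormD (c1 - c2 : R[i]^o) (c5 - c6 - (c3 - c4)).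
  have := ler_rnormB (c1 : R[i]^o) c2.
  have := ler_rnormB (c5 - c6 : R[i]^o) (c3 - c4).
  have := ler_rnormB (c5 : R[i]^o) c6.
  have := ler_rnormB (c3 : R[i]^o) c4.
  rewrite /=; lra.
rewrite (_ : z - x = (z - a) + (a - b) - (x - b)); last by rewrite addrA subrK opprB addrA subrK.
rewrite (le_lt_trans (ler_rnormB _ _))//.
have := ler_rnormD (z - a) (a - b).
move: ab za xb; rewrite /d; lra.
Qed.

End dot_precompact.

(** * Linear functionals as Bloch functions *)

Lemma weight_upper_bound (R : realType) (nu : normal_weight R) :
  exists M : R, forall t, 0 <= t < 1 -> nu t <= M.
Proof.
case: (weightP nu) => cnu nu0 [d [a [b [[/andP[d0 d1] a0 _] [dec _ _ _]]]]].
have cd : {within `[0, d], continuous nu}.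
  apply: continuous_subspaceW cnu => t /=.
  by rewrite !in_itv/= => /andP[-> /le_lt_trans->].
have [c cI cmax] := EVT_max d0 cd.
pose q := nu d / (1 - d) `^ a.
have q0 : 0 <= q by rewrite divr_ge0 ?powR_ge0// ltW// nu0// d0.
exists (Num.max (nu c) q) => t /andP[t0 t1]; rewrite le_max; have [td|td] := leP t d.
  by rewrite cmax// in_itv/= t0.
have pa : 0 < (1 - t) `^ a by rewrite powR_gt0// subr_gt0.
have : nu t / (1 - t) `^ a <= q.
  by apply: dec; rewrite ?in_itv/= ?lexx ?d1 ?t1 ?(ltW td).
rewrite ler_pdivrMr// => ntq; apply/orP; right; rewrite (le_trans ntq)// ler_piMr//.
have p1 : (1 : R) `^ a = 1 by rewrite powR1.
rewrite -[leRHS]p1.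
by apply: (ge0_ler_powR (ltW a0)); rewrite ?nnegrE; lra.
Qed.

(** Needed because a Bloch function is cut off to 0 outside the ball and agrees with a functional
    only inside. *)
Lemma is_diff_near_eq (R : numFieldType) (V W : normedModType R) (f g : V -> W) x :
  (\forall y \near x, f y = g y) -> differentiable f x ->
  differentiable g x /\ 'd g x = 'd f x :> (V -> W).
Proof.
move=> fg df; have [cf ef] := (diff_locallyP _ _).1 df.
have eg : g \o shift x = cst (g x) + 'd f x +o_ (0 : V) id.
  apply/eqaddoP => e e0; have := (eqaddoP _ _ _ _).1 ef e e0.
  have fg0 : \forall h \near (0 : V), f (h + x) = g (h + x).
    have /nbhs_ballP[d d0 fgd] := fg; apply/nbhs_ballP; exists d => //= h.
    rewrite -ball_normE/= sub0r normrN => hd; apply: fgd.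
    by rewrite -ball_normE/= opprD addrCA subrr addr0 normrN.
  apply: filterS2 fg0 => h /= fgh.
  by rewrite !fctE/= fgh (nbhs_singleton fg).
have dg : 'd g x = 'd f x :> (V -> W) by exact: diff_unique.
by split=> //; apply/diff_locallyP; rewrite dg.
Qed.

Lemma rnorm_bounded_set (R : realType) (V : normedModType R[i]) (A : set V) (M : R) :
  (forall x, A x -> rnorm x <= M) -> bounded_set A.
Proof.
move=> AM; rewrite /= /bounded_near; near=> m; move=> x /AM xM /=; apply: (@le_trans _ _ M%:C).
  by rewrite -rnormE lecR.
by near: m; apply: nbhs_pinfty_ge; rewrite complex_real.
Unshelve. all: by end_near. Qed.

Section dot_bloch.
Variables (R : realType) (X : normedModType R[i]).
Variable dot : {dot X for (@Num.conj R[i])}.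
Hypothesis dotE : forall x : X, `|x| ^+ 2 = dot x x.

(** A linear functional is its own radial derivative and vanishes at 0, so an upper bound of the
    weight bounds its Bloch norm uniformly in [y]. *)
Lemma bloch_dot (nu : normal_weight R) : exists M : R,
  forall y : X, rnorm y <= 1 -> exists f : bloch X nu,
  (forall z, unit_ball X z -> f z = dot z y) /\ rnorm f <= M.
Proof.
have [M nuM] := weight_upper_bound nu; exists M => y y1.
pose f z : R[i]^o := if rnorm z < 1 then dot z y else 0.
have fE z : unit_ball X z -> f z = dot z y by rewrite /f => ->.
have df z : unit_ball X z -> differentiable f z /\ 'd f z = dotl dot y :> (X -> _).
  move=> z1; have yc := @dotl_continuous _ _ _ dotE y.
  have [] := @is_diff_near_eq _ _ _ (dotl dot y) f z.
  - have d0 : 0 < (1 - rnorm z)%:C :> R[i] by rewrite ltcR subr_gt0.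
    apply/nbhs_ballP; exists (1 - rnorm z)%:C => // x /norm_ballP zx.
    rewrite fE// /unit_ball/= -[x](subrK z) (le_lt_trans (ler_rnormD _ _))//.
    by rewrite rnormB_sym; lra.
  - exact: linear_differentiable.
  by move=> df ->; rewrite diff_lin.
have bv x : bloch_values nu f x -> x <= M.
  move=> [z z1 <-]; rewrite /radial_derivative (df z z1).2 /dotl.
  have zr : 0 <= rnorm z < 1 by rewrite rnorm_ge0.
  rewrite -[M]mulr1 ler_pM ?rnorm_ge0 ?nuM//; first by rewrite ltW// weight_gt0.
  rewrite (le_trans (dot_cauchy_schwarz dotE _ _))// mulr_ile1 ?rnorm_ge0// ltW//.
have fb : f \in bloch_pred X nu.
  apply/asboolP; split; [by move=> z /df[]| |by exists M].
  by move=> z /negP; rewrite -leNgt /f ltNge => ->.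
exists (Bloch fb); split=> //.
have -> : rnorm (Bloch fb) = rnorm (f 0) + sup (bloch_values nu f) by [].
rewrite (fE 0 (unit_ball0 X)) linear0l rnorm0 add0r; apply: ge_sup => //.
by eexists; exists 0 => //; exact: unit_ball0.
Qed.

End dot_bloch.

(* [psi_neq0] excludes the zero operator, which is compact for every [phi]. *)
Theorem theorem6p4 (R : realType) (X : completeNormedModType R[i])
    (dot : {dot X for (@Num.conj R[i])})
    (dotE : forall x : X, `|x| ^+ 2 = dot x x)
    (X_infinite_dim : infinite_dim X)
    (mu nu : normal_weight R)
    (psi : X -> R[i]^o) (phi : X -> X)
    (psi_holomorphic : holomorphic psi)
    (psi_neq0 : exists2 z, unit_ball X z & psi z != 0)
    (phi_self_map : holomorphic_self_map phi)
    (W : {linear bloch X nu -> bloch X mu})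
    (WE : forall (f : bloch X nu) (z : X), unit_ball X z ->
       W f z = psi z * f (phi z))
    (W_compact : compact_operator W)
    (r : R) (r_ge0 : 0 <= r) (r_lt1 : r < 1) :
  precompact (phi @` [set r%:C *: z | z in unit_ball X]).
Proof.
have [phi_hol phi_ball] := phi_self_map.
have [M FM] := bloch_dot dotE nu.
have /boolp.choice[F FP] : forall y : X, exists f : bloch X nu, rnorm y <= 1 ->
    (forall z, unit_ball X z -> f z = dot z y) /\ rnorm f <= M.
  by move=> y; have [/FM[f fP]|_] := leP (rnorm y) 1; [exists f|exists 0].
pose D : set X := [set y | rnorm y <= 1].
have WFD : precompact ((fun y => W (F y)) @` D).
  rewrite -(image_comp F W); apply: W_compact.
  by apply: (rnorm_bounded_set (M := M)) => _ [y /FP[_ yM] <-].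
have [z0 z01 psi0] := psi_neq0.
have c0 : 0 < rnorm (psi z0) / 2 by rewrite divr_gt0// lt_neqAle rnorm_ge0 eq_sym rnorm_eq0 psi0.
set c := _ / 2 in c0.
pose r1 := (1 + rnorm z0) / 2.
have z0r1 : rnorm z0 < r1 by move: z01; rewrite /unit_ball/= /r1; lra.
have r11 : r1 < 1 by move: z01; rewrite /unit_ball/= /r1; lra.
have [rho rho0 rhoP] : exists2 rho : R, 0 < rho & forall x, rnorm (x - z0) <= rho ->
    rnorm x <= r1 /\ c <= rnorm (psi x).
  have cpsi : psi x @[x --> z0] --> psi z0.
    exact/differentiable_continuous/psi_holomorphic.
  have cC : 0 < c%:C :> R[i] by rewrite ltcR.
  move: cpsi => /cvgrPdist_lt/(_ _ cC)/nbhs_ballP[d' d'0 dP].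
  have [d d0 dE] : exists2 d : R, 0 < d & d' = d%:C.
    exists (complex.Re d'); last by rewrite RRe_real// gtr0_real.
    by rewrite -ltcR RRe_real// gtr0_real.
  exists (Num.min (d / 2) (r1 - rnorm z0)).
    by rewrite lt_min divr_gt0//= subr_gt0.
  move=> x; rewrite le_min => /andP[xd xr]; split.
    by rewrite -[x](subrK z0) (le_trans (ler_rnormD _ _))//; lra.
  have /dP : ball z0 d' x by rewrite dE; apply/norm_ballP; rewrite rnormB_sym; lra.
  rewrite /= -rnormE ltcR => psix.
  have := ler_rnormD (psi z0 - psi x) (psi x); rewrite subrK.
  by move: psix; rewrite /c; lra.
have [C C0 growth] := bloch_growth X mu r11.
apply: (precompact_dot dotE).
  move=> _ [_ [z z1 <-] <-]; apply: ltW; apply: phi_ball; apply: unit_ballZ => //.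
  by rewrite r_ge0 ltW.
move=> e e0; have e2 : 0 < e / 2 by rewrite divr_gt0.
have [eta eta0 small] := small_propagates z01 rho0 r_lt1 e2.
(* [growth] turns this distance into [c * eta], and division by [psi], of modulus at least [c] near
   [z0], leaves [eta]. *)
have tau0 : 0 < c * eta / C by rewrite divr_gt0// mulr_gt0.
have [s sD net] := precompact_finite_net WFD tau0.
exists s; first exact: sD.
move=> y y1; have [y' y's yy'] := net y y1; exists y' => //.
have y'1 : rnorm y' <= 1 := sD _ y's.
(* As [y - y'] has norm at most 2, the factor 1 / 2 gives the bound 1 that [small] requires; the
   target is [e / 2] accordingly. *)
pose g : X -> R[i]^o := (2^-1 : R)%:C *: (dotl dot (y - y') \o phi).
have Ng x : rnorm (g x) = 2^-1 * cnorm (dot (phi x) (y - y')).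
  by rewrite /g fctE rnormZr.
move=> _ [_ [z z1 <-] <-].
have : rnorm (g (r%:C *: z)) <= e / 2; last first.
  by rewrite Ng; lra.
apply: small.
- move=> x x1; apply: differentiableZ; apply: differentiable_comp; first exact: phi_hol.
  exact/linear_differentiable/dotl_continuous.
- move=> x /phi_ball px; rewrite Ng ler_pdivrMl// mulr1.
  rewrite (le_trans (dot_cauchy_schwarz dotE _ _))//.
  rewrite -[2]mul1r ler_pM ?rnorm_ge0 ?(ltW px)//.
  by rewrite (le_trans (ler_rnormB _ _))//; lra.
- move=> x /rhoP[xr1 xc].
  have x1 : unit_ball X x by rewrite /unit_ball/= (le_lt_trans xr1).
  have := growth (W (F y) - W (F y')) x xr1.
  have -> : (W (F y) - W (F y')) x = psi x * dot (phi x) (y - y') :> R[i].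
    transitivity (W (F y) x - W (F y') x) => //.
    rewrite !WE// (FP y y1).1 ?(FP y' y'1).1 ?linearBr ?mulrBr//; exact: phi_ball.
  rewrite cnormM => H.
  have H1 : rnorm (psi x) * cnorm (dot (phi x) (y - y')) <= c * eta.
    rewrite (le_trans H)// mulrC -ler_pdivlMr//; exact: ltW.
  have H2 : c * cnorm (dot (phi x) (y - y')) <= c * eta.
    by rewrite (le_trans _ H1)// ler_wpM2r ?rnorm_ge0.
  rewrite Ng; move: H2; rewrite ler_pM2l//.
  have := rnorm_ge0 (dot (phi x) (y - y') : R[i]^o); lra.
- by rewrite rnormZr// ler_piMr// ltW.
Qed.
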